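(* Let $(B,\|\cdot\|)$ be a separable Banach space. The following three statements are equivalent: (i) $B$ is type 2. (ii) There is a constant $c\in(0,\infty)$ such that for all non-degenerate $B$-valued random variables $X$ and all $r>0$, $$E T_r\ge \frac{c}{h(r)}.$$ (iii) There is a constant $c\in(0,\infty)$ such that for all non-degenerate $B$-valued random variables $X$, all $r>0$ and all integers $n\ge 1$, $$P(T_r\le n)\le c\,n\,h(r).$$ Moreover, the constants appearing in the three equivalent statements may be taken to depend only on each other.
   Context: For a $B$-valued random variable $X$ let $X_1,X_2,\dots$ be independent copies of $X$, $S_n=\sum_{j=1}^n X_j$, and for $r>0$ let $T_r=\min\{n\ge 1:\|S_n\|>r\}$. Non-degenerate means not almost surely constant. Write $E(Y;A)=E(Y\mathbf 1_A)$ (Bochner expectation when $Y$ is $B$-valued). For $r>0$ define $$G(r)=P(\|X\|>r),\quad K(r)=r^{-2}E(\|X\|^2;\|X\|\le r),\quad M(r)=r^{-1}E(X;\|X\|\le r),$$ $$h(r)=G(r)+K(r)+\|M(r)\|.$$ Both $T_r$ and $h$ depend on (the distribution of) $X$; the constants $c$ in the statements do not depend on $X$, $r$ or $n$. $B$ is type 2 if there is a constant $c\in(0,\infty)$ such that for every $n\ge1$ and every sequence of independent $B$-valued random variables $X_1,\dots,X_n$ with $EX_i=0$ and $E\|X_i\|^2<\infty$ for $1\le i\le n$, $$E\Big\|\sum_{i=1}^n X_i\Big\|^2\le c\sum_{i=1}^n E\|X_i\|^2;$$ any such $c$ is called a type 2 constant for $B$, and it is the constant associated with the statement ''$B$ is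 type 2''. ''The constants may be taken to depend only on each other'' means: if one of the statements holds with constant $c$, then each other statement holds with a constant that is determined by $c$ alone. *)

(* Defs.v *)
From HB Require Import structures.
From mathcomp Require Import all_boot all_order all_algebra finmap.
From mathcomp Require Import all_classical all_reals all_analysis.
Import Order.TTheory GRing.Theory Num.Theory.
Import numFieldNormedType.Exports.

Set Implicit Arguments.
Unset Strict Implicit.
Unset Printing Implicit Defensive.

Local Open Scope classical_set_scope.
Local Open Scope ring_scope.

Definition separable (T : topologicalType) :=
  exists D : set T, countable D /\ dense D.

Section RandomVariables.
Context {R : realType} {B : completeNormedModType R}.

(* The carrier B with its Borel sigma-algebra; only used to express
   measurability, so that random variables keep the plain type T -> B. *)
Definition borel : Type := g_sigma_algebraType (@open B).

Definition borel_set (A : set B) := <<s @open B >> A.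

Definition random_variable d (T : measurableType d) (X : T -> B) :=
  measurable_fun setT (X : T -> borel).

Definition same_law d (T : measurableType d) (P : probability T R)
    d' (T' : measurableType d') (P' : probability T' R)
    (X : T -> B) (X' : T' -> B) :=
  forall A, borel_set A -> P' (X' @^-1` A) = P (X @^-1` A).

Definition independent d (T : measurableType d) (P : probability T R)
    (I : choiceType) (X : I -> T -> B) :=
  forall (J : {fset I}) (A : I -> set B), (forall i, borel_set (A i)) ->
    P (\bigcap_(i in [set` J]) (X i @^-1` A i)) =
    (\prod_(i <- J) P (X i @^-1` A i))%E.

Definition non_degenerate d (T : measurableType d) (P : probability T R)
    (X : T -> B) :=
  ~ exists b : B, {ae P, forall w, X w = b}.

Definition simple_function d (T : measurableType d) (s : T -> B) :=
  random_variable s /\ finite_set (range s).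

Definition simple_expectation d (T : measurableType d) (P : probability T R)
    (s : T -> B) : B :=
  \sum_(b \in range s) fine (P (s @^-1` [set b])) *: b.

(* X is Bochner integrable with integral m. *)
Definition is_bochner d (T : measurableType d) (P : probability T R)
    (X : T -> B) (m : B) :=
  random_variable X /\
  exists s : nat -> T -> B,
    [/\ forall k, simple_function (s k),
        (\int[P]_w `|X w - s k w|%:E)%E @[k --> \oo] --> 0%E
      & simple_expectation P (s k) @[k --> \oo] --> m].

(* Bochner expectation; 0 if X is not Bochner integrable. *)
Definition bochner d (T : measurableType d) (P : probability T R)
    (X : T -> B) : B := xget 0 (is_bochner P X).

Section LawQuantities.
Context d (T : measurableType d) (P : probability T R) (X : T -> B).

Definition G (r : R) : R := fine (P [set w | r < `|X w|]).

Definition K (r : R) : R :=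
  r ^- 2 * \int[P]_(w in [set w | `|X w| <= r]) (`|X w| ^+ 2).

Definition M (r : R) : B :=
  r^-1 *: bochner P (fun w => \1_[set w | `|X w| <= r] w *: X w).

Definition h (r : R) : R := G r + K r + `|M r|.

End LawQuantities.

(* The sequence is indexed from 0: X 0 is the first summand. *)
Definition partial_sum (T : Type) (X : nat -> T -> B) (n : nat) (w : T) : B :=
  \sum_(j < n) X j w.

(* Equal to +oo if the partial sums never leave the ball of radius r. *)
Definition exit_time (T : Type) (X : nat -> T -> B) (r : R) (w : T) : \bar R :=
  ereal_inf [set n%:R%:E | n in
    [set n | (1 <= n)%N /\ r < `|partial_sum X n w|]].

(* X' is a sequence of independent copies of X, possibly defined on another
   probability space. *)
Definition independent_copies d (T : measurableType d) (P : probability T R)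
    d' (T' : measurableType d') (P' : probability T' R)
    (X : T -> B) (X' : nat -> T' -> B) :=
  [/\ forall j, random_variable (X' j),
      forall j, same_law P P' X (X' j)
    & independent P' X'].

End RandomVariables.
Arguments borel {R} B.

Section Statements.
Context {R : realType}.
Implicit Types (B : completeNormedModType R) (c : R).

Definition type2_with B c :=
  forall d (T : measurableType d) (P : probability T R)
    (n : nat) (X : 'I_n -> T -> B),
    (1 <= n)%N ->
    (forall i, random_variable (X i)) ->
    independent P X ->
    (forall i, is_bochner P (X i) 0) ->
    (forall i, \int[P]_w (`|X i w| ^+ 2)%:E < +oo)%E ->
    (\int[P]_w (`|\sum_(i < n) X i w| ^+ 2)%:E <=
      c%:E * \sum_(i < n) \int[P]_w (`|X i w| ^+ 2)%:E)%E.

Definition exit_mean_with B c :=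
  forall d (T : measurableType d) (P : probability T R) (X : T -> B)
    d' (T' : measurableType d') (P' : probability T' R) (X' : nat -> T' -> B),
    random_variable X -> non_degenerate P X ->
    independent_copies P P' X X' ->
    forall r : R, 0 < r ->
      ((c / h P X r)%:E <= \int[P']_w exit_time X' r w)%E.

Definition exit_tail_with B c :=
  forall d (T : measurableType d) (P : probability T R) (X : T -> B)
    d' (T' : measurableType d') (P' : probability T' R) (X' : nat -> T' -> B),
    random_variable X -> non_degenerate P X ->
    independent_copies P P' X X' ->
    forall (r : R) (n : nat), 0 < r -> (1 <= n)%N ->
      (P' [set w | exit_time X' r w <= n%:R%:E] <= (c * n%:R * h P X r)%:E)%E.

(* A property S B c of a space B and a constant c, with some c in (0, oo). *)
Definition with_some_constant
    (S : completeNormedModType R -> R -> Prop) B :=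
  exists c, 0 < c /\ S B c.

(* S1 with constant c implies S2 with a constant determined by c alone:
   c' is chosen before the space. *)
Definition constant_transfers
    (S1 S2 : completeNormedModType R -> R -> Prop) :=
  forall c, 0 < c -> exists c', 0 < c' /\
    forall B, separable B -> S1 B c -> S2 B c'.

End Statements.

(* Main.v *)
(* (i) => (iii): truncate the steps at radius r and recentre them. When n h(r) is
   small the total drift up to time n is at most r/4, so leaving the ball forces
   either a jump larger than r or a large maximal partial sum of the centred
   truncated steps; the latter is controlled by Kolmogorov's inequality and the
   type 2 bound.

   (iii) => (ii): E T >= (n + 1) P(T > n) with n of order 1/h(r).

   (ii) => (i): let X be uniform on {+-x_1, ..., +-x_n}. Surviving k n steps in
   the ball of radius r requires k independent survivals of n steps in the ball
   of radius 2r, so E T_r <= n / P(T_2r <= n), and (ii) says that the walk leaves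
   a ball of radius a multiple of (sum |x_i|^2)^(1/2) within n steps with
   probability at most 1/8. Leaving a ball k times larger requires k successive
   such exits, whence an exponential tail and a bound on E |S_n|^2. Now
   S_n = sum_i W_i x_i, where the signs of the net counts W_i are independent
   of their absolute values and E |W_i| >= 1/2, so E |S_n|^2 dominates the
   second moment of the Rademacher sum of the x_i. Finally a sum of centred
   independent variables is symmetrized. *)
From HB Require Import structures.
Require Import Defs.
From mathcomp Require Import all_boot all_order all_algebra finmap.
From mathcomp Require Import all_classical all_reals all_analysis.
From mathcomp Require Import measurable_realfun perm ring lra.
Import Order.TTheory GRing.Theory Num.Theory.
Import numFieldNormedType.Exports.
(* [random_variable] is also a name of MathComp-Analysis. *)
Import Defs.

Set Implicit Arguments.
Unset Strict Implicit.
Unset Printing Implicit Defensive.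

Local Open Scope classical_set_scope.
Local Open Scope ring_scope.

(** * Averages over finite alphabets and random words *)

(** The hard direction must bound sums of independent variables with different laws, knowing only
    i.i.d. walks. The walk on the signed vectors manages this because n h(r) = sum |x_i|^2 / r^2 is
    free of n once r bounds every step. Since (ii) speaks of actual random variables, such a walk
    has to exist: it is read off the base-q digits of a point of [0, 1). Its probabilities are then
    averages over finite words ([wavg]), where conditioning on the first steps amounts to
    concatenation.

    Conditional expectation is replaced by one inequality, |u| <= E |u + V| for all u ([centered]).
    With Tonelli it shows that adding an independent centred summand does not decrease a second
    moment, even restricted to an event of the past. Kolmogorov's inequality follows. So does
    symmetrization, without independent copies or random signs: deleting summands cannot increase
    the second moment, so E |sum X_i|^2 <= 4 E |sum e_i X_i|^2 for each fixed sign pattern e. After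
    summing over all patterns, the Rademacher bound applies pointwise to the vectors X_i(w). *)

Section Average.
Context {R : realType}.
Implicit Types A : finType.

Definition avg A (f : A -> R) : R := (\sum_a f a) / #|A|%:R.

Lemma eq_avg A (f g : A -> R) : f =1 g -> avg f = avg g.
Proof. by move=> fg; rewrite /avg; congr (_ / _); apply: eq_bigr. Qed.

Lemma avg_le A (f g : A -> R) : (forall a, f a <= g a) -> avg f <= avg g.
Proof. by move=> fg; rewrite /avg ler_wpM2r ?invr_ge0// ler_sum. Qed.

Lemma avg_ge0 A (f : A -> R) : (forall a, 0 <= f a) -> 0 <= avg f.
Proof. by move=> f0; rewrite /avg mulr_ge0 ?invr_ge0// sumr_ge0. Qed.

Lemma avgD A (f g : A -> R) : avg (fun a => f a + g a) = avg f + avg g.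
Proof. by rewrite /avg big_split mulrDl. Qed.

Lemma avgZ A k (f : A -> R) : avg (fun a => k * f a) = k * avg f.
Proof. by rewrite /avg -mulr_sumr mulrA. Qed.

Lemma avgZr A k (f : A -> R) : avg (fun a => f a * k) = avg f * k.
Proof. by rewrite /avg -mulr_suml mulrAC. Qed.

Lemma avg_cst A k : (0 < #|A|)%N -> avg (fun _ : A => k) = k.
Proof.
by move=> A0; rewrite /avg sumr_const -(mulr_natr k) mulfK// pnatr_eq0 -lt0n.
Qed.

Lemma avg_sum A (I : Type) (s : seq I) (f : I -> A -> R) :
  avg (fun a => \sum_(i <- s) f i a) = \sum_(i <- s) avg (f i).
Proof. by rewrite /avg exchange_big mulr_suml. Qed.

Lemma exchange_avg A A' (f : A -> A' -> R) :
  avg (fun a => avg (f a)) = avg (fun b => avg (f ^~ b)).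
Proof.
rewrite /avg; under eq_bigr do rewrite mulr_suml.
under [in RHS]eq_bigr do rewrite mulr_suml.
rewrite exchange_big !mulr_suml; apply: eq_bigr => b _.
rewrite !mulr_suml; apply: eq_bigr => a _; exact: mulrAC.
Qed.

Lemma reindex_avg A (p : A -> A) (f : A -> R) : bijective p ->
  avg (fun a => f (p a)) = avg f.
Proof.
move=> bp; rewrite /avg; congr (_ / _).
by rewrite [RHS](reindex p)//; apply: onW_bij.
Qed.

Lemma sqr_avg_le A (f : A -> R) : avg f ^+ 2 <= avg (fun a => f a ^+ 2).
Proof.
have [A0|] := posnP #|A|.
  have -> : avg f = 0 by rewrite /avg A0 invr0 mulr0.
  by rewrite expr0n avg_ge0// => a; exact: sqr_ge0.
move=> A0; have : 0 <= avg (fun a => (f a - avg f) ^+ 2).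
  by apply: avg_ge0 => a; exact: sqr_ge0.
rewrite (@eq_avg _ _ (fun a => f a ^+ 2 + ((- 2 * avg f) * f a + avg f ^+ 2))).
  by rewrite avgD avgD avgZ avg_cst//; nra.
by move=> a; ring.
Qed.

Lemma sqr_norm_avg_le (B : normedModType R) A (v : A -> B) :
  `|#|A|%:R^-1 *: \sum_a v a| ^+ 2 <= avg (fun a => `|v a| ^+ 2).
Proof.
apply: le_trans (sqr_avg_le _); rewrite ler_sqr ?nnegrE//; last first.
  exact: avg_ge0.
rewrite normrZ ger0_norm ?invr_ge0// /avg mulrC ler_wpM2r ?invr_ge0//.
exact: ler_norm_sum.
Qed.

(** [F] takes lists rather than tuples, so that words can be split and extended without casts
    between lengths. *)
Definition wavg A n (F : seq A -> R) := avg (fun t : n.-tuple A => F t).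

Lemma wavg0 A (F : seq A -> R) : wavg 0 F = F [::].
Proof.
rewrite /wavg /avg (eq_bigr (fun=> F [::])).
  by rewrite sumr_const card_tuple expn0 divr1.
by move=> t _; rewrite tuple0.
Qed.

Lemma wavgS A n (F : seq A -> R) :
  wavg n.+1 F = avg (fun a => wavg n (fun w => F (a :: w))).
Proof.
rewrite /wavg /avg -mulr_suml -mulrA -invfM -natrM card_tuple expnS mulnC card_tuple.
congr (_ / _).
rewrite (reindex (fun p : A * n.-tuple A => [tuple of p.1 :: p.2])) /=.
  by rewrite pair_big.
exists (fun t : n.+1.-tuple A => (thead t, [tuple of behead t])).
- move=> [a t] _ /=; congr (_, _); last exact/val_inj.
- by move=> t _; apply/val_inj; case/tupleP: t.
Qed.

Lemma wavg_cat A m n (F : seq A -> R) :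
  wavg (m + n) F = wavg m (fun u => wavg n (fun v => F (u ++ v))).
Proof.
elim: m F => [|m ih] F; first by rewrite wavg0.
by rewrite addSn !wavgS; apply: eq_avg => a; rewrite ih.
Qed.

Lemma wavg_map A n (p : A -> A) (F : seq A -> R) : bijective p ->
  wavg n (fun w => F (map p w)) = wavg n F.
Proof.
move=> bp; elim: n F => [|n ih] F; first by rewrite !wavg0.
rewrite !wavgS /=; rewrite -[RHS](reindex_avg _ bp); apply: eq_avg => a.
exact: (ih (fun w => F (p a :: w))).
Qed.

Lemma wavg_le A n (F F' : seq A -> R) :
  (forall w, size w = n -> F w <= F' w) -> wavg n F <= wavg n F'.
Proof. by move=> FF; apply: avg_le => t; rewrite FF// size_tuple. Qed.

Lemma wavg_ge0 A n (F : seq A -> R) : (forall w, 0 <= F w) -> 0 <= wavg n F.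
Proof. by move=> F0; apply: avg_ge0. Qed.

Lemma wavg_cst A n k : (0 < #|A|)%N -> wavg n (fun _ : seq A => k) = k.
Proof. by move=> A0; rewrite /wavg avg_cst// card_tuple expn_gt0 A0. Qed.

End Average.

(** * Survival and exit probabilities of a walk in a ball *)

Section Walk.
Context {R : realType} {B : normedModType R} {A : finType}.
Variable (x : A -> B).
Implicit Types (r s : R) (y : B) (w : seq A).
Hypothesis A_gt0 : (0 < #|A|)%N.

(** The starting point [y] itself is not tested, in accordance with exit times that begin at n =
    1. *)
Fixpoint confined r y w : bool :=
  if w is a :: w' then (`|y + x a| <= r) && confined r (y + x a) w' else true.

Lemma confined_cat r y u v :
  confined r y (u ++ v) = confined r y u && confined r (y + \sum_(a <- u) x a) v.
Proof.
elim: u y => [|a u ih] y /=; first by rewrite big_nil addr0.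
by rewrite ih andbA big_cons addrA.
Qed.

Lemma confined_norm r y w : `|y| <= r -> confined r y w ->
  `|y + \sum_(a <- w) x a| <= r.
Proof.
elim: w y => [|a w ih] y yr /=; first by rewrite big_nil addr0.
by move=> /andP[yar] /(ih _ yar); rewrite big_cons addrA.
Qed.

Lemma confined_shift r s y y' w : `|y - y'| <= s ->
  confined r y w -> confined (r + s) y' w.
Proof.
elim: w y y' => [//|a w ih] y y' ys /= /andP[yar c].
rewrite (ih _ _ _ c) ?andbT; last first.
  by rewrite opprD addrACA subrr addr0.
have -> : y' + x a = (y + x a) - (y - y').
  by rewrite opprB [RHS]addrC addrA subrK.
by rewrite (le_trans (ler_normB _ _))// lerD.
Qed.

Definition stay r n := wavg n (fun w => (confined r 0 w)%:R : R).
Definition leave r y n := wavg n (fun w => (~~ confined r y w)%:R : R).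

Lemma leaveE r n : leave r 0 n = 1 - stay r n.
Proof.
apply/eqP; rewrite -subr_eq opprK; apply/eqP.
rewrite /leave /stay /wavg -avgD -[RHS](@wavg_cst R A n 1 A_gt0); apply: eq_avg => t.
by case: confined; rewrite /= ?addr0 ?add0r.
Qed.

(** Each block of n steps starts at a point of norm at most r; moving that point to the origin costs
    r in the radius and makes the blocks independent. *)
Lemma stay_mul r n k : 0 <= r -> stay r (k * n) <= stay (r + r) n ^+ k.
Proof.
move=> r0; elim: k => [|k ih].
  by rewrite mul0n /stay wavg0 expr0 /=.
rewrite mulSnr exprSr /stay wavg_cat.
rewrite -/(stay (r + r) n); apply: le_trans (_ : stay r (k * n) * stay (r + r) n <= _).
  rewrite /stay /wavg -avgZr; apply: avg_le => u; rewrite -avgZ.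
  apply: avg_le => v; rewrite confined_cat -natrM mulnb.
  case cu: (confined r 0 u) => //=; rewrite ler_nat.
  case cv: (confined _ _ v) => //=.
  rewrite (confined_shift _ cv)// subr0 confined_norm//; by rewrite normr0.
by rewrite ler_wpM2r// wavg_ge0.
Qed.

Lemma leave_ge0 r y n : 0 <= leave r y n.
Proof. by apply: wavg_ge0 => w. Qed.

Lemma leave_le1 r y n : leave r y n <= 1.
Proof.
rewrite -(@wavg_cst R A n 1 A_gt0); apply: wavg_le => w _.
by case: confined.
Qed.

Lemma leaveS r y n : leave r y n.+1 =
  avg (fun a => if `|y + x a| <= r then leave r (y + x a) n else 1).
Proof.
rewrite /leave wavgS; apply: eq_avg => a /=.
by case: ifP => // _; rewrite wavg_cst.
Qed.

Lemma leave_nondecreasing r y n : leave r y n <= leave r y n.+1.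
Proof.
elim: n y => [|n ih] y.
  by rewrite /leave wavg0 /= wavg_ge0.
rewrite leaveS [leRHS]leaveS; apply: avg_le => a.
by case: ifP.
Qed.

Lemma leave_shift r s y n : `|y| <= s -> leave (r + s) y n <= leave r 0 n.
Proof.
move=> ys; apply: wavg_le => w _; case c: (confined r 0 w) => /=; last first.
  by case: confined.
by rewrite (confined_shift _ c)// sub0r normrN.
Qed.

Variable sigma : R.
Hypothesis x_le : forall a, `|x a| <= sigma.

(** To leave the large ball the walk must first leave the ball of radius r, landing within r + sigma
    because steps are bounded by sigma, and then travel further than s. Fewer than n steps remain
    for this, and monotonicity in the number of steps restores n. *)
Lemma leave_add r s y n : 0 <= s -> `|y| <= r ->
  leave (s + (r + sigma)) y n <= leave r y n * leave s 0 n.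
Proof.
move=> s0; elim: n y => [|n ih] y yr; first by rewrite /leave !wavg0 /= mulr0.
rewrite leaveS [leave r y _]leaveS -avgZr; apply: avg_le => a.
have yas : `|y + x a| <= r + sigma by rewrite (le_trans (ler_normD _ _))// lerD.
rewrite (le_trans yas) ?lerDr//; case: ifP => yar.
  apply: le_trans (ih _ yar) _; rewrite ler_wpM2l ?leave_ge0//.
  exact: leave_nondecreasing.
by rewrite mul1r (le_trans (leave_shift _ _ yas))// leave_nondecreasing.
Qed.

Lemma leave_exp s n k : 0 <= s -> 0 <= sigma ->
  leave ((s + sigma) *+ k) 0 n <= leave s 0 n ^+ k.
Proof.
move=> s0 sigma0; elim: k => [|k ih]; first by rewrite expr0 leave_le1.
rewrite mulrSr addrCA exprSr.
apply: le_trans (leave_add n s0 _) _.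
  by rewrite normr0 mulrn_wge0// addr_ge0.
by rewrite ler_wpM2r// leave_ge0.
Qed.

End Walk.

(** * From an exponential tail to a second moment *)

Section SecondMoment.
Context {R : realType}.

(** If b m < t <= b (m + 1), the last nonzero term alone is enough, since (m + 1)^2 <= 4^m. Weights
    growing like 4^m are affordable against a tail that decays like 8^-m. *)
Lemma sqr_le_geometric (b t : R) n : 0 <= b -> t <= b *+ n -> 0 <= t ->
  t ^+ 2 <= b ^+ 2 * \sum_(m < n) 4 ^+ m * (b *+ m < t)%R%:R.
Proof.
move=> b0 + t0; elim: n => [|n ih] tn.
  by rewrite (le_anti (introT andP (conj tn t0))) big_ord0 mulr0 expr0n.
rewrite big_ord_recr /= mulrDr.
have [tbn|] := leP t (b *+ n).
  by rewrite mulr0 mulr0 addr0 ih.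
move=> bnt; rewrite mulr1 -[leLHS]add0r lerD//.
  by rewrite mulr_ge0 ?exprn_ge0// sumr_ge0// => i _; rewrite mulr_ge0 ?exprn_ge0.
apply: (@le_trans _ _ ((b *+ n.+1) ^+ 2)).
  by rewrite ler_sqr ?nnegrE ?mulrn_wge0.
rewrite -(mulr_natr b) exprMn ler_wpM2l ?exprn_ge0//.
rewrite -!natrX ler_nat -[4%N]/(2 ^ 2)%N -expnM mulnC expnM leq_exp2r//.
exact: ltn_expl.
Qed.

Context {B : normedModType R} {A : finType}.
Variables (x : A -> B) (sigma : R).
Hypothesis A_gt0 : (0 < #|A|)%N.
Hypothesis x_le : forall a, `|x a| <= sigma.
Hypothesis sigma_ge0 : 0 <= sigma.

Lemma norm_sum_le (w : seq A) : `|\sum_(a <- w) x a| <= sigma *+ size w.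
Proof.
elim: w => [|a w ih]; first by rewrite big_nil normr0.
by rewrite big_cons mulrS (le_trans (ler_normD _ _))// lerD.
Qed.

Lemma second_moment_le s n : 0 <= s -> leave x s 0 n <= 8^-1 ->
  wavg n (fun w => `|\sum_(a <- w) x a| ^+ 2) <= 2 * (s + sigma) ^+ 2.
Proof.
move=> s0 l8; set b := s + sigma; have b0 : 0 <= b by rewrite addr_ge0.
apply: (@le_trans _ _
  (b ^+ 2 * \sum_(m < n) 4 ^+ m * leave x (b *+ m) 0 n)).
  have -> : b ^+ 2 * \sum_(m < n) 4 ^+ m * leave x (b *+ m) 0 n =
      wavg n (fun w => b ^+ 2 * \sum_(m < n)
        4 ^+ m * (~~ confined x (b *+ m) 0 w)%:R).
    rewrite /wavg avgZ avg_sum; congr (_ * _).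
    by apply: eq_bigr => m _; rewrite avgZ.
  apply: wavg_le => w wn.
  (* n layers suffice, because the sum of n steps has norm at most n sigma <= n b. *)
  apply: le_trans (@sqr_le_geometric b _ n b0 _ _) _ => //.
    by rewrite -wn (le_trans (norm_sum_le _))// lerMn2r lerDr s0 orbT.
  rewrite ler_wpM2l ?exprn_ge0// ler_sum// => m _.
  rewrite ler_wpM2l ?exprn_ge0// ler_nat.
  case c: confined; last by case: ltP.
  have := confined_norm _ c; rewrite normr0 mulrn_wge0// add0r => /(_ isT).
  by rewrite leNgt => /negbTE ->.
rewrite mulrC ler_wpM2r ?exprn_ge0//.
(* The threshold 1/8 turns the weighted tail into (4 / 8)^m, a geometric series with sum at most
   2. *)
apply: (@le_trans _ _ (\sum_(m < n) 2^-1 ^+ m)).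
  apply: ler_sum => m _; apply: (@le_trans _ _ (4 ^+ m * 8^-1 ^+ m)).
    rewrite ler_wpM2l ?exprn_ge0// (le_trans (leave_exp A_gt0 x_le n m s0 sigma_ge0))//.
    by rewrite lerXn2r ?nnegrE ?leave_ge0// invr_ge0.
  rewrite -exprMn lerXn2r ?nnegrE//; lra.
have -> : \sum_(m < n) 2^-1 ^+ m = 2 - 2 * 2^-1 ^+ n :> R.
  elim: n {l8} => [|n ih]; first by rewrite big_ord0 expr0; ring.
  by rewrite big_ord_recr /= ih exprS; field.
by rewrite gerBl mulr_ge0// exprn_ge0.
Qed.

End SecondMoment.

(** * Comparison of Rademacher sums with a random walk *)

Section Rademacher.
Context {R : realType} {B : normedModType R} {n : nat}.
Variable (x : 'I_n -> B).
Hypothesis n_gt0 : (0 < n)%N.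

Definition signed_step (a : 'I_n * bool) : B := (-1) ^+ a.2 *: x a.1.

Definition letter_sign (i : 'I_n) (a : 'I_n * bool) : R :=
  (a.1 == i)%:R * (-1) ^+ a.2.

Definition net_count (i : 'I_n) (w : seq ('I_n * bool)) : R :=
  \sum_(a <- w) letter_sign i a.

Lemma letters_gt0 : (0 < #|{: 'I_n * bool}|)%N.
Proof. by rewrite card_prod card_bool card_ord muln_gt0 n_gt0. Qed.

Lemma sum_signed_step w :
  \sum_(a <- w) signed_step a = \sum_i net_count i w *: x i.
Proof.
under [RHS]eq_bigr do rewrite scaler_suml.
rewrite [RHS]exchange_big /=; apply: eq_bigr => a _.
rewrite (bigD1 a.1)//= big1 ?addr0 /letter_sign ?eqxx ?mul1r// => i ia.
by rewrite eq_sym (negbTE ia) mul0r scale0r.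
Qed.

(** Two symmetries of the alphabet, hence of the law of a random word: [flip] changes the signs of
    chosen net counts, and [swap] shows that all net counts have the same law. *)
Definition flip (e : {ffun 'I_n -> bool}) (a : 'I_n * bool) := (a.1, a.2 (+) e a.1).
Definition swap (i j : 'I_n) (a : 'I_n * bool) := (tperm i j a.1, a.2).

Lemma flip_bij e : bijective (flip e).
Proof. by exists (flip e) => -[i s]; rewrite /flip /= addbK. Qed.

Lemma swap_bij i j : bijective (swap i j).
Proof. by exists (swap i j) => -[k s]; rewrite /swap /= tpermK. Qed.

Lemma net_count_flip e i w :
  net_count i (map (flip e) w) = (-1) ^+ e i * net_count i w.
Proof.
rewrite /net_count big_map mulr_sumr; apply: eq_bigr => -[k s] _.
rewrite /letter_sign /=; case: eqP => [->|_]; last by rewrite !mul0r mulr0.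
by rewrite !mul1r signr_addb mulrC.
Qed.

Lemma net_count_swap i j w :
  net_count i (map (swap i j) w) = net_count j w.
Proof.
rewrite /net_count big_map; apply: eq_bigr => -[k s] _.
by rewrite /letter_sign /= -[X in tperm _ _ _ == X](tpermR i j) (inj_eq perm_inj).
Qed.

(** One letter contributes 0 with probability 1 - 1/n and each of 1, -1 with probability 1/(2n).
    Taking f(z) = (z + t)^2 and (z + t)^4 gives the moment recurrences below. *)
Lemma avg_letter_sign i (f : R -> R) :
  avg (fun a => f (letter_sign i a)) =
  (1 - n%:R^-1) * f 0 + n%:R^-1 * (f 1 + f (-1)) / 2.
Proof.
have nN : n%:R != 0 :> R by rewrite pnatr_eq0 -lt0n.
rewrite /avg card_prod card_bool card_ord.
rewrite -(pair_big xpredT xpredT (fun k s => f (letter_sign i (k, s)))) /=.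
rewrite (bigD1 i)//= [X in _ + X](eq_bigr (fun=> f 0 *+ 2)); last first.
  move=> k ki; rewrite big_bool /letter_sign /= (negbTE ki) !mul0r; exact: mulr2n.
rewrite sumr_const big_bool /letter_sign /= eqxx !mul1r expr0 expr1.
have -> : #|[pred k | k != i]| = n.-1.
  by have := cardC1 i; rewrite card_ord => <-; apply: eq_card => k.
rewrite -mulrnA -(mulr_natr (f 0)) !natrM.
have -> : n.-1%:R = n%:R - 1 :> R by rewrite -[in RHS](prednK n_gt0) -addn1 natrD addrK.
by field.
Qed.

Lemma net_count_moment2 i k :
  wavg k (fun w => net_count i w ^+ 2) = k%:R / n%:R.
Proof.
elim: k => [|k ih]; first by rewrite wavg0 /net_count big_nil expr0n mul0r.
rewrite wavgS; under eq_avg do rewrite /net_count.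
have -> : avg (fun a => wavg k (fun w => net_count i (a :: w) ^+ 2)) =
  wavg k (fun w => avg (fun a => (letter_sign i a + net_count i w) ^+ 2)).
  rewrite /wavg exchange_avg; apply: eq_avg => t; apply: eq_avg => a.
  by rewrite /net_count big_cons.
rewrite -natr1 mulrDl -ih -(@wavg_cst R _ k (1 / n%:R) letters_gt0).
rewrite /wavg -avgD; apply: eq_avg => t.
by rewrite (avg_letter_sign i (fun z => (z + _) ^+ 2)); field; rewrite pnatr_eq0 -lt0n.
Qed.

Lemma net_count_moment4 i k :
  wavg k (fun w => net_count i w ^+ 4) =
  k%:R / n%:R + 3 * k%:R * (k%:R - 1) / n%:R ^+ 2.
Proof.
have nN : n%:R != 0 :> R by rewrite pnatr_eq0 -lt0n.
elim: k => [|k ih]; first by rewrite wavg0 /net_count big_nil expr0n /=; ring.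
rewrite wavgS.
have -> : avg (fun a => wavg k (fun w => net_count i (a :: w) ^+ 4)) =
  wavg k (fun w => avg (fun a => (letter_sign i a + net_count i w) ^+ 4)).
  rewrite /wavg exchange_avg; apply: eq_avg => t; apply: eq_avg => a.
  by rewrite /net_count big_cons.
have -> : wavg k (fun w => avg (fun a => (letter_sign i a + net_count i w) ^+ 4))
  = wavg k (fun w => net_count i w ^+ 4) +
    (6 / n%:R * wavg k (fun w => net_count i w ^+ 2) + 1 / n%:R).
  rewrite -[X in _ + (_ + X)](@wavg_cst R _ k (1 / n%:R) letters_gt0).
  rewrite /wavg -avgZ -!avgD; apply: eq_avg => t.
  by rewrite (avg_letter_sign i (fun z => (z + _) ^+ 4)); field.
by rewrite ih net_count_moment2 -natr1; field.
Qed.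

(** A second moment equal to 1 and a fourth moment at most 4 keep the count away from 0: |t| >= 3/4
    t^2 - t^4 / 16 integrates to 3/4 - 4/16 = 1/2. *)
Lemma norm_net_count_ge i : 2^-1 <= wavg n (fun w => `|net_count i w|).
Proof.
have nN : n%:R != 0 :> R by rewrite pnatr_eq0 -lt0n.
have m4 : wavg n (fun w => net_count i w ^+ 4) <= 4.
  rewrite net_count_moment4.
  have -> : n%:R / n%:R + 3 * n%:R * (n%:R - 1) / n%:R ^+ 2 = 4 - 3 / n%:R :> R by field.
  by rewrite gerBl divr_ge0.
have m2 : wavg n (fun w => net_count i w ^+ 2) = 1.
  by rewrite net_count_moment2 divff.
apply: (@le_trans _ _ (wavg n (fun w =>
    3 / 4 * net_count i w ^+ 2 + - (1 / 16) * net_count i w ^+ 4))).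
  by rewrite /wavg avgD !avgZ -/(wavg n (fun w => net_count i w ^+ 2))
    -/(wavg n (fun w => net_count i w ^+ 4)) m2; lra.
apply: wavg_le => w _; set t := net_count i w.
rewrite -(real_normK (num_real t)) -[t ^+ 4]/(t ^+ (2 * 2)) exprM -(real_normK (num_real t)).
(* The weights come from u (u - 2)^2 (u + 4) >= 0 with u = |t|. *)
have := normr_ge0 t; move: `|t| => u u0.
have : 0 <= u * (u - 2) ^+ 2 * (u + 4).
  by rewrite mulr_ge0 ?addr_ge0// mulr_ge0 ?sqr_ge0.
by nra.
Qed.

(** The sign of each c_i can be absorbed into e_i, which permutes the sign patterns. *)
Lemma avg_sign_norm (c : 'I_n -> R) :
  avg (fun e : {ffun 'I_n -> bool} => `|\sum_i (-1) ^+ e i *: (c i *: x i)| ^+ 2) =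
  avg (fun e : {ffun 'I_n -> bool} => `|\sum_i (-1) ^+ e i *: (`|c i| *: x i)| ^+ 2).
Proof.
pose p (e : {ffun 'I_n -> bool}) := [ffun i => e i (+) (c i < 0)%R].
have bp : bijective p by exists p => e; apply/ffunP => i; rewrite !ffunE addbK.
rewrite -[RHS](reindex_avg _ bp); apply: eq_avg => e; congr (`|_| ^+ 2).
apply: eq_bigr => i _; rewrite ffunE signr_addb !scalerA -mulrA; congr (_ * _ *: _).
by rewrite {1}[c i]realEsign ?num_real.
Qed.

Lemma rademacher_le_walk :
  avg (fun e : {ffun 'I_n -> bool} => `|\sum_i (-1) ^+ e i *: x i| ^+ 2) <=
  4 * wavg n (fun w => `|\sum_(a <- w) signed_step a| ^+ 2).
Proof.
pose i0 := Ordinal n_gt0; pose al := wavg n (fun w => `|net_count i0 w|).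
have alE i : wavg n (fun w => `|net_count i w|) = al.
  rewrite /al -[RHS](wavg_map _ _ (swap_bij i0 i)).
  by apply: eq_avg => t; rewrite net_count_swap.
have al2 : 4^-1 <= al ^+ 2.
  have := norm_net_count_ge i0; rewrite -/al => h; nra.
(* Invariance under every [flip e] allows an average over uniform signs to be inserted. *)
have -> : wavg n (fun w => `|\sum_(a <- w) signed_step a| ^+ 2) =
    avg (fun e : {ffun 'I_n -> bool} => wavg n (fun w =>
      `|\sum_i (-1) ^+ e i *: (net_count i w *: x i)| ^+ 2)).
  rewrite -[LHS](@avg_cst R {ffun 'I_n -> bool}); last first.
    by rewrite card_ffun card_bool expn_gt0.
  apply: eq_avg => e; rewrite -[LHS](wavg_map _ _ (flip_bij e)).
  apply: eq_avg => t; rewrite sum_signed_step; congr (`|_| ^+ 2).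
  by apply: eq_bigr => i _; rewrite net_count_flip scalerA.
rewrite /wavg exchange_avg.
rewrite (eq_avg (fun t => avg_sign_norm (fun i => net_count i (tval t)))).
rewrite exchange_avg -avgZ; apply: avg_le => e.
(* For fixed signs, Jensen's inequality over the words replaces each |W_i| by its mean [al]; the
   factor 4 pays for [al] >= 1/2. *)
apply: (@le_trans _ _ (4 * `|al *: \sum_i (-1) ^+ e i *: x i| ^+ 2)).
  rewrite normrZ exprMn real_normK ?num_real// mulrA -[leLHS]mul1r.
  by rewrite ler_wpM2r ?exprn_ge0//; lra.
rewrite ler_wpM2l//; apply: le_trans (sqr_norm_avg_le _).
rewrite exchange_big /= !scaler_sumr le_eqVlt; apply/orP; left; apply/eqP.
congr (`|_| ^+ 2); apply: eq_bigr => i _.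
rewrite -scaler_sumr -scaler_suml !scalerA -(alE i) /wavg /avg.
by congr (_ *: _); rewrite [LHS]mulrAC [RHS]mulrC; congr (_ / _); exact: mulrC.
Qed.

End Rademacher.

(** * Borel random variables in a separable Banach space *)

Section BorelMeasurability.
Context {R : realType} {B : completeNormedModType R}.

Lemma separable_sequence : separable B ->
  exists e : nat -> B, forall b (eps : R), 0 < eps -> exists n, `|b - e n| < eps.
Proof.
move=> [D [/countable_injP[f finj] dD]].
(* The injection [f] of the dense set into the naturals is inverted; values it does not take are
   sent to 0. *)
exists (fun n => xget 0 [set b | D b /\ f b = n]) => b eps eps0.
have [||c [bc Dc]] := dD (ball b eps); first by exists b; exact: ballxx.
  exact: ball_open.
exists (f c); suff -> : xget 0 [set b | D b /\ f b = f c] = c.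
  by move: bc; rewrite -ball_normE.
case: xgetP => [y -> [Dy fy]|/(_ c)]; last by case.
by apply: finj; rewrite ?inE.
Qed.

Lemma continuous_borel_measurable (f : B -> R) :
  continuous f -> measurable_fun setT (f : borel B -> R).
Proof.
move=> cf; apply: (measurability _ (RGenOInfty.measurableE R)) => //.
move=> _ [_ [a ->] <-]; rewrite setTI; apply: sub_sigma_algebra.
by apply: open_comp; [move=> z _; exact: cf|exact: interval_open].
Qed.

Section RandomVariable.
Context d (T : measurableType d).
Implicit Types X Y : T -> B.

Lemma random_variable_open X :
  (forall U : set B, open U -> measurable (X @^-1` U)) -> random_variable X.
Proof.
move=> mX; apply: (measurability (rT := borel B) (@open B)) => //.
by move=> _ [U oU <-]; rewrite setTI; exact: mX.
Qed.

Lemma random_variable_preimage X A :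
  random_variable X -> borel_set A -> measurable (X @^-1` A).
Proof. by move=> mX mA; rewrite -[S in measurable S]setTI; exact: mX. Qed.

Lemma random_variable_cst b : random_variable (cst b : T -> B).
Proof. exact: measurable_cst. Qed.

Lemma random_variable_comp_continuous X (f : B -> R) :
  continuous f -> random_variable X -> measurable_fun setT (f \o X).
Proof.
move=> cf mX.
exact: (measurableT_comp (continuous_borel_measurable cf)
  (mX : measurable_fun _ (X : T -> borel B))).
Qed.

Lemma measurable_norm X : random_variable X -> measurable_fun setT (fun w => `|X w|).
Proof. by apply: random_variable_comp_continuous => z; exact: norm_continuous. Qed.

Lemma random_variable_continuous X (f : B -> B) :
  continuous f -> random_variable X -> random_variable (f \o X).
Proof.
move=> cf mX; apply: random_variable_open => U oU.
rewrite comp_preimage; apply: random_variable_preimage => //.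
apply: sub_sigma_algebra; apply: open_comp => // z _; exact: cf.
Qed.

Lemma random_variableZ X (k : R) :
  random_variable X -> random_variable (fun w => k *: X w).
Proof.
apply: (random_variable_continuous (f := fun b => k *: b)).
move=> b; exact: scaler_continuous.
Qed.

Hypothesis sepB : separable B.

(** Separability makes the event that X + Y lies in an open set a countable union of measurable
    rectangles, built from balls around the dense sequence. *)
Lemma random_variableD X Y : random_variable X -> random_variable Y ->
  random_variable (fun w => X w + Y w).
Proof.
move=> mX mY; apply: random_variable_open => U oU.
have [e he] := separable_sequence sepB.
pose V (p : nat * nat * nat) : set T :=
  [set w | ball (e p.1.1 + e p.1.2) (p.2.+1%:R^-1 + p.2.+1%:R^-1) `<=` U] `&`
  (X @^-1` ball (e p.1.1) p.2.+1%:R^-1 `&` Y @^-1` ball (e p.1.2) p.2.+1%:R^-1).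
rewrite (_ : _ @^-1` _ = \bigcup_p V p); last first.
  apply/seteqP; split => [w /= UXY|w [[[i j] k] _ [/= sub [Xi Yj]]]]; last first.
    apply: sub; move: Xi Yj; rewrite /= -!ball_normE /= => Xi Yj.
    by rewrite opprD addrACA (le_lt_trans (ler_normD _ _))// ltrD.
  have /nbhs_ballP[eps /= eps0 sub] : nbhs (X w + Y w) U by exact: open_nbhs_nbhs.
  (* A quarter of eps, since the distance to X + Y is made of four errors: one for X, one for Y and
     the doubled radius. *)
  have [k ke] : exists k, k.+1%:R^-1 < eps / 4.
    have /ltr_add_invr[k] : 0 < eps / 4 by rewrite divr_gt0.
    by rewrite add0r => ke; exists k.
  have k0 : 0 < k.+1%:R^-1 :> R by rewrite invr_gt0.
  have [i Xi] := he (X w) _ k0; have [j Yj] := he (Y w) _ k0.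
  exists (i, j, k) => //; split => /=.
    move=> z; rewrite -ball_normE /= => hz; apply: sub; rewrite -ball_normE /=.
    rewrite (_ : X w + Y w - z =
      (X w - e i) + (Y w - e j) + ((e i + e j) - z)); last first.
      by rewrite (addrACA (X w)) -opprD addrA subrK.
    apply: le_lt_trans (ler_normD _ _) _; apply: le_lt_trans (lerD (ler_normD _ _) (lexx _)) _.
    rewrite (_ : eps = (eps / 4 + eps / 4) + (eps / 4 + eps / 4)); last by field.
    have ke' := @ltW _ _ _ _ ke; rewrite ltr_leD//; first by rewrite ltrD// (lt_trans _ ke).
    by rewrite ltW// (lt_le_trans hz)// lerD.
  by rewrite -!ball_normE /=; split; rewrite distrC.
apply: countable_bigcupT_measurable => // p.
have [sub|nsub] := pselect (ball (e p.1.1 + e p.1.2) (p.2.+1%:R^-1 + p.2.+1%:R^-1) `<=` U).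
  have -> : V p = X @^-1` ball (e p.1.1) p.2.+1%:R^-1 `&` Y @^-1` ball (e p.1.2) p.2.+1%:R^-1.
    by apply/seteqP; split => w //= -[].
  apply: measurableI; apply: random_variable_preimage => //; apply: sub_sigma_algebra;
  exact: ball_open.
have -> : V p = set0 by apply/seteqP; split => w //= -[].
exact: measurable0.
Qed.

Lemma random_variable_sum (I : Type) (s : seq I) (P : pred I) (X : I -> T -> B) :
  (forall i, P i -> random_variable (X i)) ->
  random_variable (fun w => \sum_(i <- s | P i) X i w).
Proof.
move=> mX; elim: s => [|i s ih].
  have -> : (fun w => \sum_(i <- [::] | P i) X i w) = cst 0.
    by apply/funext => w; rewrite big_nil.
  exact: random_variable_cst.
have -> : (fun w => \sum_(j <- i :: s | P j) X j w) = (fun w =>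
    (if P i then X i w else 0) + \sum_(i <- s | P i) X i w).
  by apply/funext => w; rewrite big_cons; case: ifP; rewrite ?add0r.
apply: random_variableD => //; case Pi: (P i); first exact: mX.
exact: random_variable_cst.
Qed.

Lemma random_variableN X : random_variable X -> random_variable (fun w => - X w).
Proof.
move=> /(random_variableZ (-1)); congr random_variable.
by apply/funext => w; rewrite scaleN1r.
Qed.

Lemma random_variableB X Y : random_variable X -> random_variable Y ->
  random_variable (fun w => X w - Y w).
Proof. by move=> mX /random_variableN; exact: random_variableD. Qed.

End RandomVariable.
End BorelMeasurability.

(** * Tonelli and Jensen for independent variables *)

Section Fubini.
Context {R : realType}.
Local Open Scope ereal_scope.

(** Independence makes the joint law agree with the product law on rectangles, hence everywhere;
    Tonelli then integrates one variable with the other frozen. *)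
Lemma fubini_independent d (T : measurableType d) (P : probability T R)
    d1 (T1 : measurableType d1) d2 (T2 : measurableType d2)
    (f : T -> T1) (g : T -> T2) (F : T1 * T2 -> \bar R) :
  measurable_fun setT f -> measurable_fun setT g ->
  (forall A C, measurable A -> measurable C ->
    P (f @^-1` A `&` g @^-1` C) = P (f @^-1` A) * P (g @^-1` C)) ->
  measurable_fun setT F -> (forall z, 0 <= F z) ->
  \int[P]_w F (f w, g w) = \int[P]_w \int[P]_w' F (f w, g w').
Proof.
move=> mf mg ind mF F0.
pose f' : {mfun T >-> T1} := HB.pack f (isMeasurableFun.Build _ _ _ _ f mf).
pose g' : {mfun T >-> T2} := HB.pack g (isMeasurableFun.Build _ _ _ _ g mg).
have mfg : measurable_fun setT (fun w => (f w, g w)) by exact: measurable_fun_pair.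
pose fg : {mfun T >-> (T1 * T2)%type} :=
  HB.pack (fun w => (f w, g w)) (isMeasurableFun.Build _ _ _ _ _ mfg).
transitivity (\int[distribution P fg]_z F z).
  by rewrite ge0_integral_distribution.
transitivity (\int[distribution P f' \x distribution P g']_z F z).
  apply: eq_measure_integral => A mA _; apply/esym.
  apply: product_measure_unique => // C D mC mD; exact: ind.
rewrite fubini_tonelli1// ge0_integral_distribution//; last 2 first.
- exact: measurable_fun_fubini_tonelli_F.
- by move=> y; apply: integral_ge0.
apply: eq_integral => w _ /=; rewrite /fubini_F ge0_integral_distribution//.
apply: measurableT_comp => //; exact: pair1_measurable.
Qed.

End Fubini.

Section Jensen.
Context {R : realType} {B : completeNormedModType R}.
Context d (T : measurableType d) (P : probability T R).
Local Open Scope ereal_scope.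

(** The form in which a zero mean enters all second-moment comparisons; it makes sense without any
    integrability assumption. *)
Definition centered (V : T -> B) :=
  forall u, (`|u|%:E <= \int[P]_w `|u + V w|%:E).

Lemma measurable_sqr_norm d' (T' : measurableType d') (X : T' -> B) :
  random_variable X -> measurable_fun setT (fun w => (`|X w| ^+ 2)%:E).
Proof.
move=> mX; apply/measurable_EFinP; apply: measurable_funX; exact: measurable_norm.
Qed.

Hypothesis sepB : separable B.

(** With t = |u|, integrate the tangent-line bound 2 t x <= x^2 + t^2 at x = |u + V| and cancel the
    finite t^2. The right-hand side may be infinite. *)
Lemma centered_sqr (V : T -> B) u : random_variable V -> centered V ->
  (`|u| ^+ 2)%:E <= \int[P]_w (`|u + V w| ^+ 2)%:E.
Proof.
move=> mV cV; set t := `|u|%R; have t0 : (0 <= t)%R by exact: normr_ge0.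
have mW : random_variable (fun w => u + V w)%R.
  by apply: random_variableD => //; exact: random_variable_cst.
have : (t ^+ 2)%:E + (t ^+ 2)%:E <=
    \int[P]_w (`|u + V w| ^+ 2)%:E + (t ^+ 2)%:E.
  have -> : (t ^+ 2)%:E + (t ^+ 2)%:E = (2 * t)%:E * t%:E.
    by rewrite -EFinD -EFinM; congr EFin; ring.
  apply: (@le_trans _ _ ((2 * t)%:E * \int[P]_w `|u + V w|%:E)).
    by rewrite lee_wpmul2l ?lee_fin ?mulr_ge0 ?normr_ge0//; exact: cV.
  rewrite -ge0_integralZl_EFin//; last 2 first.
  - by apply/measurable_EFinP; exact: measurable_norm.
  - by rewrite mulr_ge0.
  have <- : \int[P]_w (t ^+ 2)%:E = (t ^+ 2)%:E.
    by rewrite integral_cst//= probability_setT mule1.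
  have m2 := measurable_sqr_norm mW.
  have W0 w : setT w -> 0 <= (`|u + V w| ^+ 2)%:E by rewrite lee_fin exprn_ge0.
  have T0 (w : T) : setT w -> 0 <= (t ^+ 2)%:E by rewrite lee_fin exprn_ge0.
  rewrite -ge0_integralD//.
  apply: ge0_le_integral => //=.
  - by move=> w _; rewrite -EFinM lee_fin !mulr_ge0.
  - by apply: measurable_funeM; apply/measurable_EFinP; exact: measurable_norm.
  - by apply: emeasurable_funD => //; exact: measurable_sqr_norm.
  - move=> w _; rewrite -EFinD -EFinM lee_fin.
    by have := sqr_ge0 (`|u + V w| - t)%R; rewrite sqrrB; lra.
by rewrite leeD2rE.
Qed.

(** Conditional Jensen without conditional expectations: freeze [f] and apply [centered_sqr] to the
    inner integral. [T1] will be T itself with the sigma-algebra of the past. *)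
Lemma jensen_independent d1 (T1 : measurableType d1) (f : T -> T1)
    (D : set T1) (U : T1 -> B) (V : T -> B) :
  measurable_fun setT f -> measurable D -> random_variable U ->
  random_variable V -> centered V ->
  (forall A C, measurable A -> borel_set C ->
    P (f @^-1` A `&` V @^-1` C) = P (f @^-1` A) * P (V @^-1` C)) ->
  \int[P]_w (\1_D (f w) * `|U (f w)| ^+ 2)%:E <=
  \int[P]_w (\1_D (f w) * `|U (f w) + V w| ^+ 2)%:E.
Proof.
move=> mf mD mU mV cV ind.
pose F (z : T1 * borel B) := (\1_D z.1 * `|U z.1 + (z.2 : B)| ^+ 2)%:E.
have mUV : random_variable (fun z : T1 * borel B => U z.1 + (z.2 : B))%R.
  apply: random_variableD => //.
    exact: (measurableT_comp (mU : measurable_fun _ (U : _ -> borel B)) measurable_fst).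
  exact: measurable_snd.
have mF : measurable_fun setT F.
  apply/measurable_EFinP; apply: measurable_funM.
    exact: (measurableT_comp (measurable_indic mD) measurable_fst).
  by apply: measurable_funX; exact: measurable_norm.
rewrite [leRHS](_ : _ = \int[P]_w F (f w, V w))//.
rewrite (fubini_independent mf (mV : measurable_fun _ (V : T -> borel B)))//; last first.
  by move=> z; rewrite lee_fin mulr_ge0// exprn_ge0.
have mUf : random_variable (U \o f).
  exact: (measurableT_comp (mU : measurable_fun _ (U : _ -> borel B)) mf).
apply: ge0_le_integral => //=.
- apply/measurable_EFinP; apply: measurable_funM.
    exact: (measurableT_comp (measurable_indic mD) mf).
  by apply: measurable_funX; exact: (measurable_norm mUf).
- pose g' : {mfun T >-> borel B} := HB.pack (V : T -> borel B)
    (isMeasurableFun.Build _ _ _ _ (V : T -> borel B) mV).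
  have F0 z : 0 <= F z by rewrite lee_fin mulr_ge0// exprn_ge0.
  apply: (eq_measurable_fun (fubini_F (distribution P g') F \o f)).
    move=> w _ /=; rewrite /fubini_F ge0_integral_distribution//.
    by apply: measurableT_comp => //; exact: pair1_measurable.
  apply: measurableT_comp => //; exact: measurable_fun_fubini_tonelli_F.
move=> w _; rewrite /F /= EFinM.
under eq_integral do rewrite EFinM.
rewrite ge0_integralZl_EFin//; last first.
  apply: measurable_sqr_norm; apply: random_variableD => //.
  exact: random_variable_cst.
by rewrite lee_wpmul2l ?lee_fin//; exact: centered_sqr.
Qed.

End Jensen.

(** * Independence from the past *)

Section Independence.
Context {R : realType} {B : completeNormedModType R}.
Context d (T : measurableType d) (P : probability T R) (I : choiceType).
Implicit Types (X : I -> T -> B) (J : set I).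
Local Open Scope ereal_scope.

Lemma borel_setT : borel_set [set: B].
Proof. by have := @measurableT _ (borel B). Qed.

Lemma borel_setI (A C : set B) : borel_set A -> borel_set C -> borel_set (A `&` C).
Proof. by have := @measurableI _ (borel B) A C. Qed.

Lemma independent_comp X (phi : I -> B -> B) :
  (forall i, @random_variable R B _ (borel B) (phi i)) -> independent P X ->
  independent P (fun i => phi i \o X i).
Proof.
move=> mphi indX J A mA.
apply: (indX J (fun i => phi i @^-1` A i)) => i.
exact: (random_variable_preimage (T := borel B)).
Qed.

Definition cylinders X J : set (set T) :=
  [set E | exists (F : {fset I}) (A : I -> set B),
    [/\ [set` F] `<=` J, forall i, borel_set (A i) &
        E = \bigcap_(i in [set` F]) (X i @^-1` A i)]].

(** The carrier is still T, so the identity from T to [past X J] is the random element that carries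
    the information of the X_j with j in J. *)
Definition past X J : Type := g_sigma_algebraType (cylinders X J).
HB.instance Definition _ X J := Measurable.on (past X J).

Lemma cylinders_setI_closed X J : setI_closed (cylinders X J).
Proof.
move=> _ _ [F1 [A1 [FJ1 mA1 ->]]] [F2 [A2 [FJ2 mA2 ->]]].
exists (F1 `|` F2)%fset, (fun i => (if i \in F1 then A1 i else setT) `&`
  (if i \in F2 then A2 i else setT)); split.
- by move=> i /=; rewrite inE => /orP[]; [exact: FJ1|exact: FJ2].
- by move=> i; apply: borel_setI; case: ifP => // _; exact: borel_setT.
apply/seteqP; split => [w [h1 h2] i /= _|w h].
  by split; case: ifP => // iF; [exact: h1|exact: h2].
split => i /= iF; have := h i; rewrite /= inE iF ?orbT => /(_ isT)[].
  by [].
by [].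
Qed.

Lemma cylinders1 X J i A : J i -> borel_set A -> cylinders X J (X i @^-1` A).
Proof.
move=> Ji mA; exists [fset i]%fset, (fun=> A); split => //.
  by move=> j /=; rewrite inE => /eqP ->.
apply/seteqP; split => [w h j /=|w h]; first by rewrite inE => /eqP ->.
by apply: (h i) => /=; rewrite inE.
Qed.

Lemma past_random_variable X J i : J i -> @random_variable R B _ (past X J) (X i).
Proof.
move=> Ji; move=> _ A mA; rewrite setTI; apply: sub_sigma_algebra.
exact: cylinders1.
Qed.

Lemma past_subset X J J' (A : set T) : J `<=` J' ->
  measurable (A : set (past X J)) -> measurable (A : set (past X J')).
Proof.
move=> JJ'; apply: sub_sigma_algebra2 => _ [F [C [FJ mC ->]]].
by exists F, C; split => //; exact: subset_trans JJ'.
Qed.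

Variable X : I -> T -> B.
Hypothesis mX : forall i, random_variable (X i).

Lemma cylinders_measurable J : cylinders X J `<=` measurable.
Proof.
move=> _ [F [A [_ mA ->]]]; apply: fin_bigcap_measurable => [|i _]; first exact: finite_fset.
exact: random_variable_preimage.
Qed.

Lemma past_measurable J (A : set T) :
  measurable (A : set (past X J)) -> measurable A.
Proof.
apply: smallest_sub; last exact: cylinders_measurable.
exact: sigma_algebra_measurable.
Qed.

Lemma past_id_measurable J : measurable_fun setT (id : T -> past X J).
Proof. by move=> _ A mA; rewrite setTI; exact: (past_measurable (J := J)). Qed.

Hypothesis indX : independent P X.

(** P (D & C) and P(D) P(C), as measures in D, agree on cylinders, which are stable under
    intersection and contain the whole space; hence they agree on the past. *)
Lemma past_independent J i (D : set T) (A : set B) : ~ J i ->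
  measurable (D : set (past X J)) -> borel_set A ->
  P (D `&` X i @^-1` A) = P D * P (X i @^-1` A).
Proof.
move=> nJi mD mA; set C := X i @^-1` A.
have mC : measurable C by exact: random_variable_preimage.
have PC0 : (0 <= fine (P C))%R by rewrite fine_ge0.
pose m1 : {measure set T -> \bar R} := mrestr P mC.
pose m2 : {measure set T -> \bar R} := mscale (NngNum PC0) P.
have m1E E : m1 E = P (E `&` C) by [].
have m2E E : m2 E = P C * P E.
  by rewrite -[LHS]/((fine (P C))%:E * P E) fineK// fin_num_measure.
suff : m1 D = m2 D by rewrite m1E m2E muleC.
apply: (@g_sigma_algebra_measure_unique _ R T (cylinders X J) _ (fun=> setT)) => //.
- exact: cylinders_measurable.
- move=> _; exists fset0, (fun=> setT); split => //.
    by move=> j; exact: borel_setT.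
  by apply/seteqP; split.
- by rewrite bigcup_const//; exists 0%N.
- exact: cylinders_setI_closed.
- move=> _ [F [A' [FJ mA' ->]]].
  rewrite m1E m2E.
  have iF : i \notin F by apply/negP => /FJ.
  pose A'' j := if j == i then A else A' j.
  have mA'' j : borel_set (A'' j) by rewrite /A''; case: ifP.
  (* Intersecting with C gives a cylinder again, with the new index i, so the definition of
     independence applies to both sides. *)
  have -> : \bigcap_(j in [set` F]) X j @^-1` A' j `&` C =
      \bigcap_(j in [set` (i |` F)%fset]) X j @^-1` A'' j.
    apply/seteqP; split => [w [h1 h2] j /=|w h].
      rewrite /A'' !inE => /orP[/eqP -> /=|jF]; first by rewrite eqxx.
      by case: eqP => [->//|_]; exact: h1.
    split => [j /= jF|]; last by have := h i; rewrite /A'' /= eqxx !inE eqxx; apply.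
    have := h j; rewrite /A'' /= !inE jF orbT.
    by case: eqP => [ji|_]; [rewrite -ji jF in iF|apply].
  rewrite indX// indX// big_fsetU1//= {1}/A'' eqxx; congr (_ * _).
  rewrite big_seq [RHS]big_seq; apply: eq_bigr => j jF.
  by rewrite /A''; case: eqP => [ji|//]; rewrite -ji jF in iF.
- by move=> k; rewrite m1E ltey_eq fin_num_measure//; exact: measurableI.
Qed.

End Independence.

(** * Second moments of sums of centred variables *)

Section Centered.
Context {R : realType} {B : completeNormedModType R}.
Context d (T : measurableType d) (P : probability T R).
Hypothesis sepB : separable B.
Local Open Scope ereal_scope.

Lemma add_centered (I : choiceType) (X : I -> T -> B) (J : set I) i
    (D : set (past X J)) (U : past X J -> B) :
  (forall i, random_variable (X i)) -> independent P X ->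
  centered P (X i) -> ~ J i -> measurable D -> random_variable U ->
  \int[P]_w (\1_D w * `|U w| ^+ 2)%:E <=
  \int[P]_w (\1_D w * `|U w + X i w| ^+ 2)%:E.
Proof.
move=> mX indX cX nJi mD mU.
apply: (@jensen_independent _ _ _ _ P sepB _ (past X J) id D U (X i)) => //.
  exact: past_id_measurable.
by move=> A C mA mC; exact: (past_independent mX indX nJi mA mC).
Qed.

Lemma centered_sum_le (I : choiceType) (X : I -> T -> B) (s1 s2 : seq I) :
  (forall i, random_variable (X i)) -> independent P X ->
  (forall i, centered P (X i)) -> uniq (s1 ++ s2) ->
  \int[P]_w (`|\sum_(i <- s2) X i w| ^+ 2)%:E <=
  \int[P]_w (`|\sum_(i <- s1 ++ s2) X i w| ^+ 2)%:E.
Proof.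
move=> mX indX cX; elim: s1 => [//|i s1 ih] /= /andP[nis us].
apply: le_trans (ih us) _.
pose J : set I := [set` s1 ++ s2].
pose U (w : past X J) : B := (\sum_(j <- s1 ++ s2) X j w)%R.
have := @add_centered _ X J i setT U mX indX (cX i) _ measurableT.
have -> : (\int[P]_w (`|\sum_(j <- s1 ++ s2) X j w| ^+ 2)%:E =
    \int[P]_w (\1_(setT : set T) w * `|U w| ^+ 2)%:E).
  by apply: eq_integral => w _; rewrite indicE in_setT mul1r.
have -> : (\int[P]_w (`|\sum_(j <- (i :: s1) ++ s2) X j w| ^+ 2)%:E =
    \int[P]_w (\1_(setT : set T) w * `|U w + X i w| ^+ 2)%:E).
  by apply: eq_integral => w _; rewrite indicE in_setT mul1r /= big_cons addrC.
apply; first exact/negP.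
(* The guard records that only indices in J occur, as measurability with respect to the past
   requires. *)
have -> : U = (fun w => \sum_(j <- s1 ++ s2 | j \in s1 ++ s2) X j w)%R.
  by apply/funext => w; rewrite /U big_seq.
apply: random_variable_sum => // j js; exact: past_random_variable.
Qed.

(** The sum of the X_i is the difference of two subsums of the signed sum, each with second moment
    at most that of the signed sum; |a - b|^2 <= 2 |a|^2 + 2 |b|^2 gives the factor 4. *)
Lemma sign_le_sum (I : finType) (X : I -> T -> B) (e : I -> bool) :
  (forall i, random_variable (X i)) -> independent P X ->
  (forall i, centered P (X i)) -> (forall i, centered P (fun w => - X i w)%R) ->
  \int[P]_w (`|\sum_i X i w| ^+ 2)%:E <=
  4%:E * \int[P]_w (`|\sum_i (-1) ^+ e i *: X i w| ^+ 2)%:E.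
Proof.
move=> mX indX cX cNX.
pose Y i w := ((-1) ^+ e i *: X i w)%R.
have mY i : random_variable (Y i) by exact: random_variableZ.
have indY : independent P Y.
  apply: (@independent_comp _ _ _ _ P _ X (fun i b => (-1) ^+ e i *: b)%R) => // i.
  exact: (@random_variableZ _ B _ (borel B) id _ (@measurable_id _ (borel B) setT)).
have cY i : centered P (Y i).
  rewrite /Y; case: (e i); last by under eq_fun do rewrite scale1r; exact: cX.
  by under eq_fun do rewrite scaleN1r; exact: cNX.
set E := \int[P]_w (`|\sum_i Y i w| ^+ 2)%:E.
have part (Q : pred I) : \int[P]_w (`|\sum_(i | Q i) Y i w| ^+ 2)%:E <= E.
  under eq_integral do rewrite -big_filter.
  apply: le_trans (@centered_sum_le _ Y [seq i <- index_enum I | ~~ Q i] _ mY indY cY _) _.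
    rewrite cat_uniq !filter_uniq ?index_enum_uniq ?enum_uniq//= andbT.
    by apply/hasPn => i; rewrite !mem_filter => /andP[-> _].
  rewrite le_eqVlt; apply/orP; left; apply/eqP; apply: eq_integral => w _.
  congr (`|_| ^+ 2)%:E; apply: perm_big.
  by rewrite perm_catC; apply/permPl/perm_filterC.
have mQ (Q : pred I) : measurable_fun setT
    (fun w => (`|\sum_(i | Q i) Y i w| ^+ 2)%:E).
  by apply: measurable_sqr_norm; apply: random_variable_sum.
have Q0 (Q : pred I) w : setT w -> 0 <= (`|\sum_(i | Q i) Y i w| ^+ 2)%:E.
  by rewrite lee_fin exprn_ge0.
apply: (@le_trans _ _ (\int[P]_w (2%:E * ((`|\sum_(i | ~~ e i) Y i w| ^+ 2)%:E +
    (`|\sum_(i | e i) Y i w| ^+ 2)%:E)))).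
  apply: ge0_le_integral => //=.
  - by apply: measurable_sqr_norm; apply: random_variable_sum.
  - by apply: measurable_funeM; exact: emeasurable_funD.
  move=> w _; rewrite -EFinD -EFinM lee_fin.
  have -> : (\sum_i X i w = \sum_(i | ~~ e i) Y i w - \sum_(i | e i) Y i w)%R.
    rewrite (bigID e) /= addrC -sumrN; congr (_ + _)%R; apply: eq_bigr => i.
      by move=> /negbTE ei; rewrite /Y ei scale1r.
    by move=> ei; rewrite /Y ei scaleN1r opprK.
  set a := (\sum_(i | ~~ e i) Y i w)%R; set b := (\sum_(i | e i) Y i w)%R.
  apply: (@le_trans _ _ ((`|a| + `|b|) ^+ 2)%R).
    by rewrite ler_sqr ?nnegrE ?addr_ge0// ler_normB.
  by have := sqr_ge0 (`|a| - `|b|)%R; rewrite sqrrB sqrrD; lra.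
rewrite ge0_integralZl_EFin//; last 2 first.
- by move=> w _; rewrite adde_ge0// Q0.
- exact: emeasurable_funD.
rewrite ge0_integralD//.
have -> : 4%:E = 2%:E * 2%:E :> \bar R by rewrite -EFinM; congr EFin; ring.
rewrite -muleA lee_wpmul2l ?lee_fin//.
have -> : 2%:E * E = E + E by rewrite mule_natl mule2n.
by apply: leeD.
Qed.

Section MaximalInequality.
Variable X : nat -> T -> B.
Hypothesis mX : forall i, random_variable (X i).

(** Time 0 is harmless: the empty sum has norm 0, which never exceeds a radius a >= 0. *)
Definition crossed (a : R) n : set T :=
  [set w | exists2 j, (j <= n)%N & (a < `|partial_sum X j w|)%R].

Lemma crossed0 a : (0 <= a)%R -> crossed a 0 = set0.
Proof.
move=> a0; apply/seteqP; split => // w [j]; rewrite leqn0 => /eqP ->.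
by rewrite /partial_sum big_ord0 normr0 ltNge a0.
Qed.

Lemma crossedS a n :
  crossed a n.+1 = crossed a n `|` [set w | (a < `|partial_sum X n.+1 w|)%R].
Proof.
apply/seteqP; split => w.
  move=> [j]; rewrite leq_eqVlt => /orP[/eqP ->|jn] h; first by right.
  by left; exists j.
by move=> [[j jn h]|h]; [exists j => //; exact: leqW|exists n.+1].
Qed.

Lemma partial_sum_past n :
  @random_variable R B _ (past X [set j | (j < n)%N]) (partial_sum X n).
Proof.
apply: random_variable_sum => // i _; apply: past_random_variable.
exact: ltn_ord.
Qed.

Lemma norm_gt_measurable d' (T' : measurableType d') (Y : T' -> B) a :
  random_variable Y -> measurable [set w | (a < `|Y w|)%R].
Proof.
move=> mY; have := measurable_fun_ltr (measurable_cst a) (measurable_norm mY).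
by move=> /(_ measurableT [set true] _); rewrite setTI; apply.
Qed.

Lemma crossed_past a n : (0 <= a)%R ->
  measurable (crossed a n : set (past X [set j | (j < n)%N])).
Proof.
move=> a0; elim: n => [|n ih]; first by rewrite crossed0//; exact: measurable0.
rewrite crossedS; apply: measurableU.
  by apply: past_subset ih => j /= jn; exact: ltnW.
exact: (@norm_gt_measurable _ (past X [set j | (j < n.+1)%N]) _ a (@partial_sum_past n.+1)).
Qed.

Lemma crossed_measurable a n : (0 <= a)%R -> measurable (crossed a n).
Proof. by move=> a0; exact: (past_measurable mX (@crossed_past a n a0)). Qed.

Hypothesis indX : independent P X.
Hypothesis cX : forall i, centered P (X i).

(* Conditionally on the past, adding a centered variable cannot decrease the
   second moment; so the mass gained at the first crossing is never lost. *)
Lemma kolmogorov a n : (0 <= a)%R ->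
  (a ^+ 2)%:E * P (crossed a n) <= \int[P]_w (`|partial_sum X n w| ^+ 2)%:E.
Proof.
move=> a0.
have mS k : random_variable (partial_sum X k) by apply: random_variable_sum.
have mI (D : set T) k : measurable D ->
    measurable_fun setT (fun w => (\1_D w * `|partial_sum X k w| ^+ 2)%:E).
  move=> mD; apply/measurable_EFinP; apply: measurable_funM => //.
  by apply: measurable_funX; exact: measurable_norm.
have I0 (D : set T) k w : setT w -> 0 <= (\1_D w * `|partial_sum X k w| ^+ 2)%:E.
  by rewrite lee_fin mulr_ge0// exprn_ge0.
have mC k := @crossed_measurable a k a0.
(* The induction keeps the indicator of the crossing event; the mass added at step n + 1 then lives
   on the disjoint event D of a first crossing. *)
apply: (@le_trans _ _
    (\int[P]_w (\1_(crossed a n) w * `|partial_sum X n w| ^+ 2)%:E)); last first.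
  apply: ge0_le_integral => //.
  - exact: mI.
  - exact: measurable_sqr_norm.
  - move=> w _; rewrite lee_fin ler_piMl ?exprn_ge0//.
elim: n => [|n ih]; first by rewrite crossed0// measure0 mule0 integral_ge0.
pose D := [set w | (a < `|partial_sum X n.+1 w|)%R] `\` crossed a n.
have mD : measurable D by apply: measurableD => //; exact: norm_gt_measurable.
have DE : crossed a n.+1 = crossed a n `|` D.
  by rewrite crossedS /D setDE setUIr setUCr setIT.
have disj : crossed a n `&` D = set0 by rewrite /D setDE setIC -setIA setICl setI0.
rewrite DE measureU// muleDr ?ge0_adde_def ?inE ?measure_ge0//.
have -> : \int[P]_w (\1_(crossed a n `|` D) w * `|partial_sum X n.+1 w| ^+ 2)%:E =
  \int[P]_w (\1_(crossed a n) w * `|partial_sum X n.+1 w| ^+ 2)%:E +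
  \int[P]_w (\1_D w * `|partial_sum X n.+1 w| ^+ 2)%:E.
  rewrite -ge0_integralD//; [|exact: mI|exact: mI].
  apply: eq_integral => w _; rewrite -EFinD -mulrDl; congr (_ * _)%:E.
  have : ~ (crossed a n w /\ D w).
    by move=> cD; have : (crossed a n `&` D) w by []; rewrite disj.
  rewrite !indicE in_setU => nCD.
  case cw: (w \in crossed a n); case Dw: (w \in D); rewrite /= ?addr0 ?add0r//.
  by exfalso; apply: nCD; split; exact/set_mem.
apply: leeD.
  apply: le_trans ih _.
  have := @add_centered _ X [set j | (j < n)%N] n (crossed a n) (partial_sum X n)
    mX indX (cX n) _ (@crossed_past a n a0) (@partial_sum_past n).
  rewrite /= ltnn => /(_ notF) h; apply: le_trans h _.
  rewrite le_eqVlt; apply/orP; left; apply/eqP; apply: eq_integral => w _.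
  by rewrite /partial_sum big_ord_recr.
apply: (@le_trans _ _ (\int[P]_w (a ^+ 2 * \1_D w)%:E)).
  rewrite (integralZl_indic measurableT (fun=> D))//; last by rewrite ltNge sqr_ge0.
  by rewrite integral_indic// setIT.
apply: ge0_le_integral => //.
- by move=> w _; rewrite lee_fin mulr_ge0// exprn_ge0.
- by apply/measurable_EFinP; apply: measurable_funM.
- exact: mI.
- move=> w _; rewrite lee_fin mulrC indicE.
  case Dw: (w \in D); rewrite ?mul0r// !mul1r.
  have [/ltW aS _] := set_mem Dw.
  by rewrite ler_sqr ?nnegrE.
Qed.

End MaximalInequality.

End Centered.

(** * Bochner expectations *)

Section SimpleExpectation.
Context {R : realType} {B : completeNormedModType R}.
Context d (T : measurableType d) (P : probability T R).

Section FiniteValues.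
Context (V : choiceType) (f : T -> V) (L : seq V).
Hypothesis uL : uniq L.
Hypothesis fL : forall w, f w \in L.
Hypothesis mf : forall v, measurable (f @^-1` [set v]).

Lemma fine_probability_preimage (Q : pred V) :
  fine (P [set w | Q (f w)]) = \sum_(v <- L | Q v) fine (P (f @^-1` [set v])).
Proof.
have -> : [set w | Q (f w)] = \bigcup_(v in [set` [seq v <- L | Q v]]) (f @^-1` [set v]).
  apply/seteqP; split => [w /= Qw|w [v /=]].
    by exists (f w) => //=; rewrite mem_filter Qw fL.
  by rewrite mem_filter => /andP[Qv _] ->.
rewrite measure_fin_bigcup//; last exact: trivIset_preimage1.
rewrite -fsbig_seq ?filter_uniq// big_filter sum_fine//.
by move=> v _; exact: fin_num_measure.
Qed.

Lemma sum_probability_preimage : \sum_(v <- L) fine (P (f @^-1` [set v])) = 1.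
Proof.
rewrite -(fine_probability_preimage xpredT).
rewrite (_ : [set w | _] = setT) ?probability_setT//.
by apply/seteqP; split.
Qed.

(** The expectation may be computed over any finite label [f] that determines the variable, not only
    over its own values. *)
Lemma simple_expectation_comp (g : V -> B) :
  simple_expectation P (g \o f) = \sum_(v <- L) fine (P (f @^-1` [set v])) *: g v.
Proof.
pose L' := undup (map g L).
have gL v : v \in L -> g v \in L' by move=> vL; rewrite mem_undup map_f.
rewrite /simple_expectation.
rewrite (@fsbig_widen _ _ _ _ _ [set` L']); last 2 first.
- by move=> _ [w _ <-] /=; exact: gL.
- move=> b /= [_ nb].
  rewrite (_ : _ @^-1` _ = set0) ?measure0 ?scale0r//.
  by apply/seteqP; split => // w /= gw; apply: nb; exists w.
rewrite -fsbig_seq ?undup_uniq//=.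
transitivity (\sum_(b <- L') \sum_(v <- L | g v == b)
    fine (P (f @^-1` [set v])) *: g v).
  apply: eq_bigr => b _.
  rewrite (_ : _ @^-1` _ = [set w | g (f w) == b]); last first.
    by apply/seteqP; split => w /= /eqP.
  rewrite (fine_probability_preimage (fun v => g v == b)) scaler_suml.
  by apply: eq_bigr => v /eqP ->.
rewrite (exchange_big_dep xpredT)//= big_seq [RHS]big_seq; apply: eq_bigr => v vL.
rewrite -big_filter (_ : [seq _ <- _ | _] = [:: g v]) ?big_seq1//.
rewrite (eq_filter (a2 := pred1 (g v))); last by move=> b /=; rewrite eq_sym.
by rewrite filter_pred1_uniq ?undup_uniq// gL.
Qed.

Lemma integral_finite_values (g : V -> R) : (forall v, 0 <= g v) ->
  (\int[P]_w (g (f w))%:E = (\sum_(v <- L) g v * fine (P (f @^-1` [set v])))%:E)%E.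
Proof.
move=> g0.
have gE w : (g (f w))%:E = (\sum_(v <- L) (g v * \1_(f @^-1` [set v]) w)%:E)%E.
  rewrite sumEFin (bigD1_seq (f w))//= big1_seq ?addr0; last first.
    move=> v /andP[vf _]; rewrite indicE memNset ?mulr0//= => fwv.
    by rewrite fwv eqxx in vf.
  by rewrite indicE mem_set// mulr1.
under eq_integral do rewrite gE.
rewrite ge0_integral_sum//; last 2 first.
- move=> v; apply/measurable_EFinP; apply: measurable_funM => //.
- by move=> v w _; rewrite lee_fin mulr_ge0.
rewrite -sumEFin; apply: eq_bigr => v _.
rewrite (integralZl_indic measurableT (fun=> f @^-1` [set v]))//; last first.
  by rewrite ltNge g0.
by rewrite integral_indic// setIT EFinM fineK// fin_num_measure.
Qed.

End FiniteValues.

Lemma finite_range_seq (V : eqType) (s : T -> V) : finite_set (range s) ->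
  exists L : seq V, uniq L /\ forall w, s w \in L.
Proof.
move=> /finite_seqP[L sL]; exists (undup L); split; first exact: undup_uniq.
by move=> w; rewrite mem_undup; have : range s (s w) by []; rewrite sL.
Qed.

Lemma random_variable_fiber (s : T -> B) b :
  random_variable s -> measurable (s @^-1` [set b]).
Proof.
move=> ms; have mY : random_variable (fun w => s w - b).
  apply: (random_variable_continuous (f := fun x => x - b)) => // x.
  by apply: cvgB; [exact: cvg_id|exact: cvg_cst].
have := measurableC (norm_gt_measurable 0 mY).
congr measurable; apply/seteqP; split => w /=.
  by move=> /negP; rewrite normr_gt0 negbK subr_eq0 => /eqP.
by move=> ->; rewrite subrr normr0 ltxx.
Qed.

Lemma simple_expectation_dist (s s' : T -> B) :
  simple_function s -> simple_function s' ->
  (`|simple_expectation P s - simple_expectation P s'|%:E <=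
   \int[P]_w `|s w - s' w|%:E)%E.
Proof.
move=> [ms /finite_range_seq[L [uL sL]]] [ms' /finite_range_seq[L' [uL' sL']]].
(* The pair is a common label for both functions, so the two expectations become sums over the same
   index. *)
pose f w := (s w, s' w); pose LL := allpairs pair L L'.
have uLL : uniq LL by apply: allpairs_uniq => // -[a b] [a' b'] _ _ [-> ->].
have fLL w : f w \in LL by apply/allpairsP; exists (s w, s' w); split => /=.
have mf v : measurable (f @^-1` [set v]).
  rewrite (_ : _ @^-1` _ = s @^-1` [set v.1] `&` s' @^-1` [set v.2]).
    by apply: measurableI; exact: random_variable_fiber.
  by apply/seteqP; split => w /=; case: v => a b; rewrite /f /= => -[-> ->].
rewrite (simple_expectation_comp uLL fLL mf fst).
rewrite (simple_expectation_comp uLL fLL mf snd).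
rewrite (integral_finite_values uLL fLL mf (g := fun v => `|v.1 - v.2|))//.
rewrite lee_fin -sumrB; under eq_bigr do rewrite -scalerBr.
apply: le_trans (ler_norm_sum _ _ _) _; apply: ler_sum => v _.
by rewrite normrZ ger0_norm ?fine_ge0// mulrC.
Qed.

Lemma simple_function_cst b : simple_function (cst b : T -> B).
Proof.
split; first exact: random_variable_cst.
by apply: (@sub_finite_set _ _ [set b]) => // _ [w _ <-].
Qed.

Lemma simple_expectation_cst b : simple_expectation P (cst b : T -> B) = b.
Proof.
rewrite (@simple_expectation_comp unit (fun=> tt) [:: tt] _ _ _ (fun=> b))//.
  rewrite big_seq1 (_ : _ @^-1` _ = setT) ?probability_setT ?scale1r//.
  by apply/seteqP; split => w //= _; case.
by move=> v; rewrite (_ : _ @^-1` _ = setT)//; apply/seteqP; split => w //= _; case: v.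
Qed.

Lemma simple_function_translate (s : T -> B) b :
  simple_function s -> simple_function (fun w => s w - b).
Proof.
move=> [ms fs]; split.
  apply: (random_variable_continuous (f := fun x => x - b)) => // x.
  by apply: cvgB; [exact: cvg_id|exact: cvg_cst].
have := finite_image (fun x => x - b) fs.
by apply: sub_finite_set => _ [w _ <-]; exists (s w).
Qed.

Lemma simple_expectation_translate (s : T -> B) b :
  simple_function s ->
  simple_expectation P (fun w => s w - b) = simple_expectation P s - b.
Proof.
move=> [ms /finite_range_seq[L [uL sL]]].
have mf v := @random_variable_fiber s v ms.
rewrite (simple_expectation_comp uL sL mf (fun x => x - b)).
rewrite (simple_expectation_comp uL sL mf id).
under eq_bigr do rewrite scalerBr.
by rewrite sumrB -scaler_suml sum_probability_preimage// scale1r.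
Qed.

End SimpleExpectation.

Section NearestPoint.
Context {R : realType} {B : completeNormedModType R}.
Variable e : nat -> B.

(** A point closest to x among 0 and the first n terms of [e]. Starting from 0 bounds the error by
    |x|, the dominating function below. Being a map on B, it commutes with changes of probability
    space. *)
Fixpoint nearest n (x : B) : B :=
  if n is m.+1 then
    if (`|x - e m| < `|x - nearest m x|)%R then e m else nearest m x
  else 0.

Lemma nearestS_le n x : `|x - nearest n.+1 x| <= `|x - nearest n x|.
Proof. by rewrite /=; case: ltP => // /ltW. Qed.

Lemma nearest_norm n x : `|x - nearest n x| <= `|x|.
Proof.
elim: n => [|n ih]; first by rewrite /= subr0.
exact: le_trans (nearestS_le _ _) ih.
Qed.

Lemma nearest_le n k x : (n < k)%N -> `|x - nearest k x| <= `|x - e n|.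
Proof.
elim: k => // k ih; rewrite ltnS leq_eqVlt => /orP[/eqP ->|nk].
  by rewrite /=; case: ltP.
exact: le_trans (nearestS_le _ _) (ih nk).
Qed.

Lemma nearest_cvg : (forall b (eps : R), 0 < eps -> exists n, `|b - e n| < eps) ->
  forall x, `|x - nearest n x| @[n --> \oo] --> (0 : R).
Proof.
move=> dense_e x; apply/cvgr0Pnorm_lt => eps eps0.
have [n xn] := dense_e x _ eps0.
exists n.+1 => // k /= nk; rewrite normr_id.
exact: le_lt_trans (nearest_le _ nk) xn.
Qed.

Hypothesis sepB : separable B.

Lemma nearest_simple n : @simple_function R B _ (borel B) (nearest n).
Proof.
elim: n => [|n [mn fn]]; first exact: simple_function_cst.
have mid : @random_variable R B _ (borel B) id by exact: (@measurable_id _ (borel B) setT).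
split.
  apply: (@measurable_fun_ifT _ _ (borel B) (borel B)
    (fun=> e n) (nearest n) (fun x : B => `|x - e n| < `|x - nearest n x|)) => //.
  apply: measurable_fun_ltr; apply: measurable_norm; apply: random_variableB => //.
  exact: random_variable_cst.
have : finite_set (range (nearest n) `|` [set e n]) by rewrite finite_setU; split.
apply: sub_finite_set => _ [x _ <-] /=.
by case: ifP => _; [right|left; exists x].
Qed.

End NearestPoint.

Section Bochner.
Context {R : realType} {B : completeNormedModType R}.
Hypothesis sepB : separable B.

Section OneSpace.
Context d (T : measurableType d) (P : probability T R).
Implicit Types X : T -> B.

Lemma simple_function_comp (phi : B -> B) X :
  @simple_function R B _ (borel B) phi -> random_variable X ->
  simple_function (phi \o X).
Proof.
move=> [mphi fphi] mX; split.
  exact: (measurableT_comp (mphi : measurable_fun _ (phi : borel B -> borel B))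
    (mX : measurable_fun _ (X : T -> borel B))).
by apply: sub_finite_set fphi => _ [w _ <-]; exists (X w).
Qed.

Lemma simple_expectation_dist_le X s s' :
  random_variable X -> simple_function s -> simple_function s' ->
  (`|simple_expectation P s - simple_expectation P s'|%:E <=
   \int[P]_w `|X w - s w|%:E + \int[P]_w `|X w - s' w|%:E)%E.
Proof.
move=> mX ss ss'; have [ms _] := ss; have [ms' _] := ss'.
apply: le_trans (simple_expectation_dist P ss ss') _.
have mn (Y Z : T -> B) : random_variable Y -> random_variable Z ->
    measurable_fun setT (fun w => (`|Y w - Z w|)%:E).
  move=> mY mZ; apply/measurable_EFinP; apply: measurable_norm.
  exact: (random_variableB sepB mY mZ).
rewrite -ge0_integralD//; [|exact: mn|exact: mn].
apply: ge0_le_integral => //.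
- exact: mn.
- by apply: emeasurable_funD; exact: mn.
- move=> w _; rewrite -EFinD lee_fin.
  have -> : s w - s' w = (X w - s' w) - (X w - s w) by rewrite opprB [RHS]addrC addrA subrK.
  by rewrite [leRHS]addrC ler_normB.
Qed.

Lemma cvg0_of_norm_le (a : nat -> B) (eps : nat -> \bar R) :
  (forall k, `|a k|%:E <= eps k)%E ->
  eps k @[k --> \oo] --> 0%E -> a k @[k --> \oo] --> (0 : B).
Proof.
move=> ae e0; apply: norm_cvg0.
have : `|a k|%:E @[k --> \oo] --> 0%E.
  apply: squeeze_cvge (@cvg_cst _ (0%E : \bar R) _ _ _) e0.
  by apply: nearW => k; rewrite lee_fin normr_ge0 ae.
by move=> /fine_cvg.
Qed.

Lemma cvg_eq (u : nat -> B) (l l' : B) :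
  u k @[k --> \oo] --> l -> u k @[k --> \oo] --> l' -> l = l'.
Proof.
move=> ul ul'.
by rewrite -(cvg_lim (@norm_hausdorff _ _) ul) (cvg_lim (@norm_hausdorff _ _) ul').
Qed.

Lemma is_bochner_unique X m m' :
  is_bochner P X m -> is_bochner P X m' -> m = m'.
Proof.
move=> [mX [s [ss sX sm]]] [_ [s' [ss' sX' sm']]].
have : (simple_expectation P (s k) - simple_expectation P (s' k)) @[k --> \oo]
    --> (0 : B).
  apply: (cvg0_of_norm_le
    (fun k => simple_expectation_dist_le mX (ss k) (ss' k))).
  by rewrite -[X in _ --> X]adde0; apply: cvgeD.
by move=> /(cvg_eq (cvgB sm sm')) /eqP; rewrite subr_eq0 => /eqP.
Qed.

Variable e : nat -> B.
Hypothesis dense_e : forall b (eps : R), 0 < eps -> exists n, `|b - e n| < eps.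

Lemma nearest_L1 X : random_variable X -> (\int[P]_w `|X w|%:E < +oo)%E ->
  (\int[P]_w `|X w - nearest e n (X w)|%:E)%E @[n --> \oo] --> 0%E.
Proof.
move=> mX iX.
have ms n := (simple_function_comp (nearest_simple e sepB n) mX).1.
have mn n : measurable_fun setT (fun w => (`|X w - nearest e n (X w)|)%:E).
  apply/measurable_EFinP; apply: measurable_norm; exact: (random_variableB sepB mX (ms n)).
have iX' : P.-integrable setT (fun w => `|X w|%:E).
  apply/integrableP; split; first by apply/measurable_EFinP; exact: measurable_norm.
  by under eq_integral do rewrite gee0_abs ?lee_fin//.
have := @dominated_convergence _ _ _ P setT measurableT
  (fun n w => (`|X w - nearest e n (X w)|)%:E) (cst 0%E) _ mn (measurable_cst _) _ iX' _.
case.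
- apply: aeW => w _.
  apply/fine_cvgP; split; first exact: nearW.
  exact: nearest_cvg.
- apply: aeW => w n _ /=; rewrite normr_id lee_fin; exact: nearest_norm.
- by move=> _ _; rewrite integral0.
Qed.

(** The expectations of the approximations form a Cauchy sequence. The second conclusion exhibits
    the mean as a limit that depends only on the law of X. *)
Lemma bochner_nearest X : random_variable X -> (\int[P]_w `|X w|%:E < +oo)%E ->
  exists2 m, is_bochner P X m &
    simple_expectation P (nearest e n \o X) @[n --> \oo] --> m.
Proof.
move=> mX iX; have ss n := simple_function_comp (nearest_simple e sepB n) mX.
have L1 := nearest_L1 mX iX.
suff : cvg (simple_expectation P (nearest e n \o X) @[n --> \oo]).
  move=> /cvg_ex[m Em]; exists m => //; split => //.
  by exists (fun n => nearest e n \o X).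
apply: cauchy_cvg; apply: cauchy_exP => eps eps0.
have : \forall n \near \oo, (\int[P]_w `|X w - nearest e n (X w)|%:E < (eps / 2)%:E)%E.
  apply: (L1 [set z | (z < (eps / 2)%:E)%E]); apply: open_ereal_lt'.
  by rewrite lte_fin divr_gt0.
move=> [N _ hN]; exists (simple_expectation P (nearest e N \o X)).
exists N => // k /= Nk; rewrite -ball_normE /=.
rewrite -lte_fin; apply: le_lt_trans (simple_expectation_dist_le mX (ss N) (ss k)) _.
rewrite [eps]splitr EFinD; apply: lteD; apply: hN => //=.
Qed.

(** Pass to the limit in |u + E s_k| <= E |u + X| + E |X - s_k|, obtained by comparing s_k with the
    constant -u. *)
Lemma centered_bochner X : is_bochner P X 0 -> centered P X.
Proof.
move=> [mX [s [ss sX s0]]] u.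
have mn (Y Z : T -> B) : random_variable Y -> random_variable Z ->
    measurable_fun setT (fun w => (`|Y w - Z w|)%:E).
  move=> mY mZ; apply/measurable_EFinP; apply: measurable_norm.
  exact: (random_variableB sepB mY mZ).
have le_k k : (`|u + simple_expectation P (s k)|%:E <=
    \int[P]_w `|u + X w|%:E + \int[P]_w `|X w - s k w|%:E)%E.
  have -> : u + simple_expectation P (s k) =
      simple_expectation P (s k) - simple_expectation P (cst (- u) : T -> B).
    by rewrite simple_expectation_cst opprK addrC.
  apply: le_trans (simple_expectation_dist_le mX (ss k) (@simple_function_cst _ B _ T (- u))) _.
  rewrite addeC; apply: leeD => //.
  by under eq_integral do rewrite opprK addrC.
have lim1 : `|u + simple_expectation P (s k)|%:E @[k --> \oo] --> `|u|%:E.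
  apply/fine_cvgP; split; first exact: nearW.
  have : u + simple_expectation P (s k) @[k --> \oo] --> u + 0.
    by apply: cvgD => //; exact: cvg_cst.
  by rewrite addr0 => /cvg_norm.
have lim2 : (\int[P]_w `|u + X w|%:E + \int[P]_w `|X w - s k w|%:E)%E @[k --> \oo]
   --> (\int[P]_w `|u + X w|%:E)%E.
  rewrite -[X in _ --> X]adde0; apply: cvgeD => //; last exact: cvg_cst.
  by rewrite adde_defC; exact: fin_num_adde_defr.
rewrite -(cvg_lim _ lim1)// -(cvg_lim _ lim2)//; apply: lee_lim.
- by apply/cvg_ex; eexists; exact: lim1.
- by apply/cvg_ex; eexists; exact: lim2.
- exact: nearW.
Qed.

Lemma is_bochner_translate X m b :
  is_bochner P X m -> is_bochner P (fun w => X w - b) (m - b).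
Proof.
move=> [mX [s [ss sX sm]]]; split.
  by apply: random_variableB => //; exact: random_variable_cst.
exists (fun k w => s k w - b); split.
- by move=> k; exact: simple_function_translate.
- rewrite [F in F @ _ --> _](_ : _ = (fun k => \int[P]_w `|X w - s k w|%:E)%E)//.
  by apply/funext => k; apply: eq_integral => w _; rewrite opprB addrA subrK.
- rewrite [F in F @ _ --> _](_ : _ = (fun k => simple_expectation P (s k) - b)).
    by apply: cvgB => //; exact: cvg_cst.
  by apply/funext => k; exact: simple_expectation_translate.
Qed.

Lemma centeredN X : centered P X -> centered P (fun w => - X w).
Proof.
move=> cX u; rewrite -normrN; apply: le_trans (cX (- u)) _.
by under eq_integral do rewrite -normrN opprD opprK.
Qed.

End OneSpace.

Lemma is_bochner_same_law d (T : measurableType d) (P : probability T R)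
    d' (T' : measurableType d') (P' : probability T' R)
    (X : T -> B) (X' : T' -> B) m :
  random_variable X -> random_variable X' -> same_law P P' X X' ->
  (\int[P]_w `|X w|%:E < +oo)%E -> (\int[P']_w `|X' w|%:E < +oo)%E ->
  is_bochner P X m -> is_bochner P' X' m.
Proof.
move=> mX mX' law iX iX' bm.
have [e dense_e] := separable_sequence sepB.
have [m1 b1 E1] := bochner_nearest dense_e mX iX.
have [m2 b2 E2] := bochner_nearest dense_e mX' iX'.
rewrite (is_bochner_unique bm b1) (_ : m1 = m2)//.
apply: (cvg_eq E1); move: E2.
rewrite [F in F @ _ --> _](_ : _ = (fun n => simple_expectation P (nearest e n \o X)))//.
apply/funext => n; have [mphi /finite_range_seq[L [uL hL]]] := nearest_simple e sepB n.
have mphiv v : borel_set (nearest e n @^-1` [set v]).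
  exact: (@random_variable_fiber _ _ _ (borel B) _ v mphi).
have E d1 (T1 : measurableType d1) (P1 : probability T1 R) (Y : T1 -> B) :
    random_variable Y -> simple_expectation P1 (nearest e n \o Y) =
    \sum_(v <- L) fine (P1 (Y @^-1` (nearest e n @^-1` [set v]))) *: v.
  move=> mY; apply: (simple_expectation_comp P1 uL _ _ id) => [w|v]; first exact: hL.
  exact: (random_variable_preimage mY (mphiv v)).
rewrite E// E//.
apply: eq_bigr => v _; congr (fine _ *: _).
exact: law (mphiv v).
Qed.

End Bochner.

(** * Exit times *)

Section ExitTime.
Context {R : realType} {B : completeNormedModType R}.
Context d (T : measurableType d) (P : probability T R).
Variable X : nat -> T -> B.
Implicit Types r : R.
Local Open Scope ereal_scope.

Lemma crossed_nondecreasing r m n : (m <= n)%N -> crossed X r m `<=` crossed X r n.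
Proof. by move=> mn w [j jm h]; exists j => //; exact: leq_trans mn. Qed.

Lemma not_crossed_exit_time r n w : ~ crossed X r n w ->
  n.+1%:R%:E <= exit_time X r w.
Proof.
move=> nc; apply: le_ereal_inf_tmp => _ [k [k1 rk] <-].
rewrite lee_fin ler_nat ltnNge; apply/negP => kn; apply: nc.
by exists k.
Qed.

Lemma crossed_exit_time r n w : (0 <= r)%R -> crossed X r n w ->
  exit_time X r w <= n%:R%:E.
Proof.
move=> r0 [[|k] kn h].
  by move: h; rewrite /partial_sum big_ord0 normr0 ltNge r0.
apply: (@le_trans _ _ k.+1%:R%:E); last by rewrite lee_fin ler_nat.
by apply: ereal_inf_lbound; exists k.+1.
Qed.

Lemma exit_time_leE r n : (0 <= r)%R ->
  [set w | exit_time X r w <= n%:R%:E] = crossed X r n.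
Proof.
move=> r0; apply/seteqP; split => w /=; last exact: crossed_exit_time.
move=> le_n; apply: contrapT => /not_crossed_exit_time /le_trans /(_ le_n).
by rewrite lee_fin ler_nat ltnn.
Qed.

(** Layer-cake formula: T is the sum over k >= 0 of the indicators of T > k, also when T is
    infinite. *)
Lemma exit_time_series r w : (0 <= r)%R ->
  exit_time X r w = \sum_(0 <= k <oo) (\1_(~` crossed X r k) w)%:E.
Proof.
move=> r0; pose a k : \bar R := (\1_(~` crossed X r k) w)%:E.
have a0 k : 0 <= a k by rewrite lee_fin.
have a1 k : ~ crossed X r k w -> a k = 1 by move=> nc; rewrite /a indicE mem_set.
have sum1 n : ~ crossed X r n w -> \sum_(0 <= k < n.+1) a k = n.+1%:R%:E.
  move=> nc; rewrite big_mkord (eq_bigr (fun=> 1)) ?sumEFin ?sumr_const ?card_ord//.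
  move=> [k /= kn] _; apply: a1 => ck; apply: nc.
  exact: crossed_nondecreasing ck.
have [[n cn]|nex] := pselect (exists n, crossed X r n w); last first.
  have nc n : ~ crossed X r n w by move=> cn; apply: nex; exists n.
  have -> : exit_time X r w = +oo.
    apply/eqyP => A A0; apply: le_trans (not_crossed_exit_time (nc (Num.truncn A))).
    by rewrite lee_fin ltW// truncnS_gt.
  apply/esym/eqyP => A A0.
  apply: le_trans (nneseries_lim_ge (Num.truncn A).+1 (fun k _ _ => a0 k)).
  by rewrite sum1// lee_fin ltW// truncnS_gt.
have exn : exists n, `[< crossed X r n w >] by exists n; exact/asboolP.
(* The first crossing time is a successor, since nothing has been crossed at time 0. *)
case: (ex_minnP exn) => -[|N] /asboolP cN minN {n cn exn}.
  by rewrite crossed0 in cN.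
have nN : ~ crossed X r N w by move=> /asboolP/minN; rewrite ltnn.
have -> : exit_time X r w = N.+1%:R%:E.
  apply/eqP; rewrite eq_le crossed_exit_time//=.
  exact: not_crossed_exit_time.
apply/esym; apply: lim_near_cst => //; exists N.+1 => // n /= Nn.
rewrite (big_cat_nat (n := N.+1))//= sum1// big_nat_cond big1 ?adde0//.
move=> k /andP[/andP[Nk _] _]; rewrite /a indicE memNset//= => nc; apply: nc.
exact: crossed_nondecreasing cN.
Qed.

Hypothesis sepB : separable B.
Hypothesis mX : forall i, random_variable (X i).

Lemma integral_exit_time r : (0 <= r)%R ->
  \int[P]_w exit_time X r w = \sum_(0 <= k <oo) P (~` crossed X r k).
Proof.
move=> r0; have mC k : measurable (~` crossed X r k).
  by apply: measurableC; exact: crossed_measurable.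
under eq_integral do rewrite exit_time_series//.
rewrite integral_nneseries//.
- by apply: eq_eseriesr => k _; rewrite integral_indic// setIT.
- by move=> k; apply/measurable_EFinP.
Qed.

Lemma integral_exit_time_ge r n : (0 <= r)%R ->
  n.+1%:R%:E * P (~` crossed X r n) <= \int[P]_w exit_time X r w.
Proof.
move=> r0; rewrite integral_exit_time//.
apply: le_trans (nneseries_lim_ge n.+1 _); last by move=> k _ _; exact: measure_ge0.
have -> : n.+1%:R%:E * P (~` crossed X r n) = \sum_(0 <= k < n.+1) P (~` crossed X r n).
  by rewrite big_mkord sumr_const card_ord mule_natl.
rewrite !big_mkord; apply: lee_sum => -[k /= kn] _.
apply: le_measure; rewrite ?inE; try by apply: measurableC; exact: crossed_measurable.
by apply: subsetC; exact: crossed_nondecreasing.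
Qed.

End ExitTime.

(** * From the tail bound to mean exit times *)

Section TailToMean.
Context {R : realType}.

Lemma h_ge0 (B : completeNormedModType R) d (T : measurableType d)
  (P : probability T R) (X : T -> B) (r : R) : 0 <= h P X r.
Proof.
rewrite /h addr_ge0// addr_ge0//; first exact: fine_ge0.
by rewrite /K mulr_ge0 ?invr_ge0 ?sqr_ge0// Rintegral_ge0// => w _; exact: sqr_ge0.
Qed.

Lemma exit_tail_mean (B : completeNormedModType R) (c : R) : separable B -> 0 < c ->
  exit_tail_with B c -> exit_mean_with B (4 * c)^-1.
Proof.
move=> sepB c0 tail d T P X d' T' P' X' mX ndX copies r r0.
have {tail} := tail _ _ _ _ _ _ _ _ mX ndX copies r.
have [mX' _ _] := copies.
set hr := h P X r => tail; have hr0 : 0 <= hr by exact: h_ge0.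
(* If h(r) = 0 the quotient is 0 by the convention for inverses, and the bound is trivial. *)
move: hr0; rewrite le_eqVlt => /predU1P[<-|hr0].
  rewrite invr0 mulr0; apply: integral_ge0 => w _.
  by apply: le_ereal_inf_tmp => _ [k _ <-]; rewrite lee_fin.
(* This n makes the tail bound at most 1/2, while n + 1 > 1 / (2 c h); the product gives 1 / (4 c
   h). *)
pose n := Num.truncn (2 * c * hr)^-1.
have chr0 : 0 < (2 * c * hr)^-1 by rewrite invr_gt0 !mulr_gt0.
apply: le_trans (integral_exit_time_ge P' sepB mX' n (ltW r0)).
have mC : measurable (crossed X' r n) by apply: crossed_measurable => //; exact: ltW.
have half : (P' (crossed X' r n) <= 2^-1%:E)%E.
  (* The tail bound is assumed only for n >= 1, so n = 0 is treated separately. *)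
  case E : n => [|k]; first by rewrite crossed0 ?measure0 ?lee_fin ?ltW.
  rewrite -E -exit_time_leE; last exact: ltW.
  apply: le_trans (tail n r0 _) _; first by rewrite E.
  rewrite lee_fin.
  have : n%:R <= (2 * c * hr)^-1 by rewrite /n truncn_le// ltW.
  rewrite -(ler_pM2r (x := c * hr)) ?mulr_gt0// => hn.
  rewrite (_ : c * n%:R * hr = n%:R * (c * hr)); last by ring.
  apply: le_trans hn _; rewrite le_eqVlt; apply/orP; left; apply/eqP; field.
  by rewrite !gt_eqF.
have ge_half : (2^-1%:E <= P' (~` crossed X' r n))%E.
  rewrite probability_setC//.
  have fP : P' (crossed X' r n) \is a fin_num by exact: fin_num_measure.
  rewrite -(fineK fP) -EFinB lee_fin.
  by rewrite -(fineK fP) lee_fin in half; lra.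
apply: (@le_trans _ _ (n.+1%:R%:E * 2^-1%:E)%E); last by rewrite lee_wpmul2l// lee_fin.
rewrite -EFinM lee_fin.
have : (2 * c * hr)^-1 < n.+1%:R by exact: truncnS_gt.
have -> : (4 * c)^-1 / hr = (2 * c * hr)^-1 / 2 by field; rewrite !gt_eqF.
by move=> /ltW; rewrite ler_pM2r.
Qed.

End TailToMean.

(** * Transfer between equal laws, and truncation *)

Section SameLaw.
Context {R : realType} {B : completeNormedModType R}.
Context d (T : measurableType d) (P : probability T R).
Context d' (T' : measurableType d') (P' : probability T' R).

Lemma integral_same_law (X : T -> B) (X' : T' -> B) (F : borel B -> \bar R) :
  random_variable X -> random_variable X' -> same_law P P' X X' ->
  measurable_fun setT F -> (forall b, 0 <= F b)%E ->
  (\int[P]_w F (X w) = \int[P']_w F (X' w))%E.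
Proof.
move=> mX mX' law mF F0.
pose Z : {mfun T >-> borel B} := HB.pack (X : T -> borel B)
  (isMeasurableFun.Build _ _ _ _ (X : T -> borel B) mX).
pose Z' : {mfun T' >-> borel B} := HB.pack (X' : T' -> borel B)
  (isMeasurableFun.Build _ _ _ _ (X' : T' -> borel B) mX').
transitivity (\int[distribution P Z]_b F b)%E.
  by rewrite ge0_integral_distribution.
transitivity (\int[distribution P' Z']_b F b)%E.
  apply: eq_measure_integral => A mA _; exact/esym/law.
by rewrite ge0_integral_distribution.
Qed.

Lemma same_law_comp (X : T -> B) (X' : T' -> B) (phi : B -> B) :
  @random_variable R B _ (borel B) phi -> same_law P P' X X' ->
  same_law P P' (phi \o X) (phi \o X').
Proof.
move=> mphi law A mA; apply: (law (phi @^-1` A)).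
exact: (random_variable_preimage (T := borel B)).
Qed.

End SameLaw.

Section Ordinals.
Context {R : realType} {B : completeNormedModType R}.
Context d (T : measurableType d) (P : probability T R).

Lemma independent_ord (X : nat -> T -> B) n : independent P X ->
  independent P (fun i : 'I_n => X i).
Proof.
move=> indX J A mA.
pose A' k := if insub k is Some i then A i else setT : set B.
have A'E (i : 'I_n) : A' i = A i by rewrite /A' valK.
have mA' k : borel_set (A' k).
  by rewrite /A'; case: insub => [i|]; [exact: mA|exact: borel_setT].
have := indX [fset val i | i in J]%fset A' mA'.
rewrite big_imfset/=; last by move=> i j _ _ /val_inj.
under eq_bigr do rewrite A'E; move=> <-; congr (P _).
apply/seteqP; split => [w h k /= /imfsetP[i /= iJ ->]|w h i /= iJ].
  by rewrite A'E; exact: h.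
by rewrite -A'E; apply: h => /=; apply/imfsetP; exists i.
Qed.

End Ordinals.

Section Truncation.
Context {R : realType} {B : completeNormedModType R}.
Hypothesis sepB : separable B.
Variable r : R.
Hypothesis r_gt0 : 0 < r.

Definition truncate (b : B) : B := \1_[set b : B | `|b| <= r] b *: b.

Lemma truncateE b : truncate b = if `|b| <= r then b else 0.
Proof.
rewrite /truncate indicE; case: ifP => br; first by rewrite mem_set// scale1r.
by rewrite memNset /= ?scale0r ?br.
Qed.

Lemma truncate_norm b : `|truncate b| <= r.
Proof. by rewrite truncateE; case: ifP => // _; rewrite normr0 ltW. Qed.

Lemma borel_id_random_variable : @random_variable R B _ (borel B) id.
Proof. exact: (@measurable_id _ (borel B) setT). Qed.

Lemma truncate_random_variable : @random_variable R B _ (borel B) truncate.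
Proof.
have -> : truncate = (fun b => if `|b| <= r then b else 0).
  by apply/funext => b; exact: truncateE.
apply: (@measurable_fun_ifT _ _ (borel B) (borel B) id (fun=> 0) (fun b : B => `|b| <= r)) => //.
apply: measurable_fun_ler; last exact: measurable_cst.
exact: (measurable_norm borel_id_random_variable).
Qed.

Context d (T : measurableType d) (P : probability T R).
Variable X : T -> B.
Hypothesis mX : random_variable X.

Lemma truncate_comp_random_variable : random_variable (truncate \o X).
Proof.
exact: (measurableT_comp
  (truncate_random_variable : measurable_fun _ (truncate : borel B -> borel B))
  (mX : measurable_fun _ (X : T -> borel B))).
Qed.

Lemma truncate_L1 : (\int[P]_w `|truncate (X w)|%:E < +oo)%E.
Proof.
apply: (@le_lt_trans _ _ (\int[P]_w r%:E)%E); last first.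
  by rewrite integral_cst//= probability_setT mule1 ltry.
apply: ge0_le_integral => //.
- by apply/measurable_EFinP; exact: (measurable_norm truncate_comp_random_variable).
- by move=> w _; rewrite lee_fin truncate_norm.
Qed.

Lemma truncate_sqr : (\int[P]_w (`|truncate (X w)| ^+ 2)%:E = (r ^+ 2 * K P X r)%:E)%E.
Proof.
rewrite /K mulrA divff ?mul1r ?expf_neq0 ?gt_eqF// /Rintegral.
have -> : (\int[P]_(w in [set w | (`|X w| <= r)%R]) (`|X w| ^+ 2)%:E =
    \int[P]_w (`|truncate (X w)| ^+ 2)%:E)%E.
  rewrite integral_mkcond; apply: eq_integral => w _; rewrite patchE truncateE.
  case: ifPn; rewrite ?inE ?notin_setE /= => h; first by rewrite h.
  by move/negP/negbTE : h => ->; rewrite normr0 expr0n.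
rewrite fineK// ge0_fin_numE; last by apply: integral_ge0 => w _; rewrite lee_fin exprn_ge0.
apply: (@le_lt_trans _ _ (\int[P]_w (r ^+ 2)%:E)%E); last first.
  by rewrite integral_cst//= probability_setT mule1 ltry.
apply: ge0_le_integral => //.
- exact: (measurable_sqr_norm truncate_comp_random_variable).
- move=> w _; rewrite lee_fin; apply: lerXn2r; rewrite ?nnegrE ?truncate_norm//; exact: ltW.
Qed.

(** A truncated variable is bounded, so [bochner] returns a genuine integral here and not its
    default value 0. *)
Lemma truncate_mean : is_bochner P (truncate \o X) (r *: M P X r).
Proof.
rewrite /M scalerA divff ?gt_eqF// scale1r.
have [e dense_e] := separable_sequence sepB.
have [m bm _] := bochner_nearest sepB dense_e truncate_comp_random_variable truncate_L1.
exact: (@xgetPex _ 0 (is_bochner P (truncate \o X)) (ex_intro _ m bm)).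
Qed.

End Truncation.

(** * From type 2 to the tail bound *)

Section TypeTwoToTail.
Context {R : realType}.

Lemma type2_exit_tail (B : completeNormedModType R) (c : R) : separable B -> 0 < c ->
  type2_with B c -> exit_tail_with B (4 + 4 * c).
Proof.
move=> sepB c0 type2 d T P X d' T' P' X' mX _ [mX' law indX'] r n r0 n1.
have r0' := ltW r0.
rewrite exit_time_leE//; set hr := h P X r.
have hr0 : 0 <= hr by exact: h_ge0.
have mC : measurable (crossed X' r n) by exact: crossed_measurable.
(* When n h(r) > 1/4 the bound exceeds 1, thanks to the summand 4 of the constant. *)
have [nh|nh] := ltP 4^-1 (n%:R * hr).
  apply: (le_trans (probability_le1 P' mC)); rewrite lee_fin -mulrA.
  rewrite (le_trans _ (_ : 4 * (n%:R * hr) <= _))//; first by lra.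
  by rewrite ler_wpM2r ?lerDl ?mulr_ge0// ltW.
pose m := r *: M P X r; pose Z j := truncate r \o X' j; pose Y j w := Z j w - m.
have mZ j : random_variable (Z j) by exact: truncate_comp_random_variable.
have mY j : random_variable (Y j).
  by apply: random_variableB => //; exact: random_variable_cst.
have bZ j : is_bochner P' (Z j) m.
  apply: (is_bochner_same_law sepB _ _ _ _ _ (truncate_mean sepB r0 P mX)) => //.
  - exact: truncate_comp_random_variable.
  - exact: (same_law_comp (truncate_random_variable r)).
  - exact: truncate_L1.
  - exact: truncate_L1.
have bY j : is_bochner P' (Y j) 0.
  by rewrite -(subrr m); exact: is_bochner_translate.
have indY : independent P' Y.
  apply: (@independent_comp _ _ _ _ P' _ X' (fun _ b => truncate r b - m)) => // j.
  apply: random_variableB => //; first exact: truncate_random_variable.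
  exact: random_variable_cst.
have cY j : centered P' (Y j) by exact: (centered_bochner sepB).
have G_le : G P X r <= hr.
  rewrite /hr /h -addrA lerDl addr_ge0// /K mulr_ge0 ?invr_ge0 ?sqr_ge0//.
  by rewrite Rintegral_ge0// => w _; exact: sqr_ge0.
have KM_le : K P X r + `|M P X r| <= hr by rewrite /hr /h -addrA lerDr fine_ge0.
have K0 : 0 <= K P X r.
  rewrite /K mulr_ge0 ?invr_ge0 ?sqr_ge0//.
  by rewrite Rintegral_ge0// => w _; exact: sqr_ge0.
have nM : n%:R * `|M P X r| <= 4^-1.
  by rewrite (le_trans _ nh)// ler_wpM2l// (le_trans _ KM_le)// lerDr.
have n1R : 1 <= n%:R :> R by rewrite ler1n.
(* This gives |M|^2 <= |M|, so that K + |M|^2 <= h in the variance bound that follows. *)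
have M1 : `|M P X r| <= 1.
  have := normr_ge0 (M P X r); nra.
have sqrY j : (\int[P']_w (`|Y j w| ^+ 2)%:E <= (2 * r ^+ 2 * hr)%:E)%E.
  apply: (@le_trans _ _ (\int[P']_w (2%:E * (`|Z j w| ^+ 2)%:E + (2 * `|m| ^+ 2)%:E)))%E.
    apply: ge0_le_integral => //.
    - exact: measurable_sqr_norm.
    - apply: emeasurable_funD => //; apply: measurable_funeM.
      exact: measurable_sqr_norm.
    - move=> w _; rewrite -EFinM -EFinD lee_fin.
      apply: (@le_trans _ _ ((`|Z j w| + `|m|) ^+ 2)).
        by rewrite ler_sqr ?nnegrE ?addr_ge0// ler_normB.
      by have := sqr_ge0 (`|Z j w| - `|m|); rewrite sqrrB sqrrD; lra.
  have m2 := measurable_sqr_norm (mZ j).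
  have m2' : measurable_fun setT (fun w => (2%:E * (`|Z j w| ^+ 2)%:E)%E).
    exact: measurable_funeM.
  have Z0 w : setT w -> (0 <= 2%:E * (`|Z j w| ^+ 2)%:E)%E.
    by rewrite -EFinM lee_fin mulr_ge0.
  rewrite ge0_integralD//.
  rewrite ge0_integralZl_EFin// integral_cst//= probability_setT mule1.
  rewrite truncate_sqr//.
  have -> : K P' (X' j) r = K P X r.
    apply: (mulfI (x := r ^+ 2)); first by rewrite expf_neq0 ?gt_eqF.
    apply: EFin_inj; rewrite -!truncate_sqr//; apply/esym.
    apply: (integral_same_law
      (F := fun b : borel B => (`|truncate r b| ^+ 2)%:E) mX (mX' j) (law j)) => //.
    exact: (measurable_sqr_norm (truncate_random_variable r)).
  rewrite -EFinM -EFinD lee_fin /m normrZ gtr0_norm// exprMn.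
  have N2 : `|M P X r| ^+ 2 <= `|M P X r| by rewrite expr2 ler_piMl.
  rewrite (_ : _ + _ = 2 * r ^+ 2 * (K P X r + `|M P X r| ^+ 2)); last by ring.
  by rewrite ler_wpM2l ?mulr_ge0 ?sqr_ge0// (le_trans _ KM_le)// lerD2l.
have sumY : (\int[P']_w (`|partial_sum Y n w| ^+ 2)%:E <=
    (c * (n%:R * (2 * r ^+ 2 * hr)))%:E)%E.
  have fin j : (\int[P']_w (`|Y j w| ^+ 2)%:E < +oo)%E.
    by apply: le_lt_trans (sqrY j) _; rewrite ltry.
  apply: le_trans (type2 _ _ _ n (fun i : 'I_n => Y i) n1 _ (independent_ord indY) _ _) _ => //.
  rewrite EFinM; apply: lee_wpmul2l; first by rewrite lee_fin ltW.
  apply: (@le_trans _ _ (\sum_(i < n) (2 * r ^+ 2 * hr)%:E)%E).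
    by apply: lee_sum => i _.
  by rewrite sumEFin sumr_const card_ord -(mulr_natl (2 * r ^+ 2 * hr)).
(* The drift takes up at most r/4, leaving 3r/4 for the centred walk; Chebyshev's constant 2 /
   (9/16) = 32/9 is rounded up to 4. *)
have crossY : (P' (crossed Y (3 / 4 * r) n) <= (4 * c * (n%:R * hr))%:E)%E.
  have a0 : 0 <= 3 / 4 * r by rewrite mulr_ge0.
  have := le_trans (kolmogorov sepB mY indY cY n a0) sumY.
  have fP : P' (crossed Y (3 / 4 * r) n) \is a fin_num.
    by apply: fin_num_measure; exact: crossed_measurable.
  rewrite -(fineK fP) -EFinM !lee_fin => hP.
  have r2 : 0 < r ^+ 2 by rewrite exprn_gt0.
  rewrite -(ler_pM2l r2).
  have : 0 <= c * (n%:R * hr) * r ^+ 2 by rewrite mulr_ge0 ?sqr_ge0// mulr_ge0 ?(ltW c0)// mulr_ge0.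
  by nra.
pose big := \big[setU/set0]_(j < n) [set w | r < `|X' j w|].
have mbig : measurable big.
  by apply: bigsetU_measurable => j _; exact: norm_gt_measurable.
have Pbig : (P' big <= (n%:R * hr)%:E)%E.
  apply: le_trans
    (@le_mu_bigsetU _ _ _ P' (fun j => [set w | r < `|X' j w|]) n _) _.
    by move=> j _; exact: norm_gt_measurable.
  apply: (@le_trans _ _ (\sum_(j < n) hr%:E)%E); last first.
    by rewrite sumEFin sumr_const card_ord mulr_natl.
  apply: lee_sum => j _; apply: (@le_trans _ _ (G P X r)%:E); last by rewrite lee_fin.
  rewrite /G fineK; last by apply: fin_num_measure; exact: norm_gt_measurable.
  rewrite le_eqVlt; apply/orP; left; apply/eqP.
  apply: (law j [set b : B | r < `|b|]).
  exact: (norm_gt_measurable r (@borel_id_random_variable R B)).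
have sub : crossed X' r n `<=` big `|` crossed Y (3 / 4 * r) n.
  move=> w [k kn rk]; have [bw|nbw] := pselect (big w); first by left.
  right; exists k => //.
  have small j : (j < n)%N -> `|X' j w| <= r.
    move=> jn; rewrite leNgt; apply/negP => rj; apply: nbw; rewrite /big.
    by rewrite -(bigcup_mkord n (fun j => [set w | r < `|X' j w|])); exists j.
  have -> : partial_sum Y k w = partial_sum X' k w - m *+ k.
    rewrite /partial_sum sumrB sumr_const card_ord; congr (_ - _).
    apply: eq_bigr => -[j /= jk] _; rewrite /Z /= truncateE small//.
    exact: leq_trans kn.
  rewrite (lt_le_trans _ (lerB_dist _ _))//.
  have : `|m *+ k| <= r / 4.
    rewrite normrMn /m normrZ gtr0_norm// -mulrnAr ler_pM2l//.
    rewrite -mulr_natl (le_trans _ nM)// ler_wpM2r// ler_nat//.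
  by lra.
apply: (@le_trans _ _ (P' (big `|` crossed Y (3 / 4 * r) n))).
  apply: le_measure; rewrite ?inE//.
  by apply: measurableU => //; apply: crossed_measurable => //; rewrite mulr_ge0.
apply: le_trans (measureU2 _ _ _) _ => //.
  by apply: crossed_measurable => //; rewrite mulr_ge0.
apply: le_trans (leeD Pbig crossY) _.
rewrite -EFinD lee_fin.
have : 0 <= n%:R * hr by rewrite mulr_ge0.
by nra.
Qed.

End TypeTwoToTail.

(** * An i.i.d. sequence of letters on the unit interval *)

Section UnitMeasure.
Context {R : realType}.

(** Uniform law on [0, 1), kept as a measure on the whole line. *)
Definition unit_measure : set (measurableTypeR R) -> \bar R :=
  mrestr (@lebesgue_measure R) (measurable_itv `[0, 1[).

HB.instance Definition _ := Measure.on unit_measure.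

Lemma unit_measureT : unit_measure setT = 1%:E.
Proof.
by rewrite /unit_measure /mrestr setTI lebesgue_measure_itv /= lte_fin ltr01 oppr0 adde0.
Qed.

HB.instance Definition _ :=
  Measure_isProbability.Build _ _ R unit_measure unit_measureT.

End UnitMeasure.

Section Digits.
Context {R : realType} {A : finType}.
Hypothesis A_gt0 : (0 < #|A|)%N.
Let q := #|A|.

Definition scaled_trunc N (x : R) := Num.truncn (q%:R ^+ N * x).

(* The k-th base-q digit of x, read as an element of A. *)
Definition letter (k : nat) (x : R) : A :=
  enum_val (Ordinal (ltn_pmod (scaled_trunc k.+1 x) A_gt0)).

Definition word N (x : R) : seq A := mkseq (letter^~ x) N.

Definition word_value (w : seq A) : nat :=
  foldl (fun v a => v * q + enum_rank a)%N 0%N w.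

Lemma word_value_rcons w a :
  word_value (rcons w a) = (word_value w * q + enum_rank a)%N.
Proof. by rewrite /word_value -cats1 foldl_cat. Qed.

Lemma word_value_inj w w' : size w = size w' -> word_value w = word_value w' -> w = w'.
Proof.
elim/last_ind: w w' => [|w a ih] w'; first by case: w'.
case/lastP: w' => [|w' a']; first by rewrite size_rcons.
rewrite !size_rcons !word_value_rcons => -[sw] ww.
have lt (b : A) : (enum_rank b < q)%N by exact: (ltn_ord (enum_rank b)).
have := congr1 (divn^~ q) ww; rewrite !divnMDl// !divn_small// !addn0 => /(ih _ sw) ->.
have := congr1 (modn^~ q) ww; rewrite !modnMDl !modn_small//.
by move=> /val_inj/enum_rank_inj ->.
Qed.

Lemma word_value_lt w : (word_value w < q ^ size w)%N.
Proof.
elim/last_ind: w => [//|w a ih]; rewrite word_value_rcons size_rcons expnSr.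
apply: (@leq_trans ((word_value w).+1 * q)); last by rewrite leq_mul2r ih orbT.
by rewrite mulSn addnC ltn_add2r; exact: ltn_ord.
Qed.

Lemma scaled_trunc_divn N x : 0 <= x -> (scaled_trunc N.+1 x %/ q)%N = scaled_trunc N x.
Proof.
move=> x0; have q0 : 0 < q%:R :> R by rewrite ltr0n.
have y0 k : 0 <= q%:R ^+ k * x by rewrite mulr_ge0// exprn_ge0// ltW.
apply/esym/truncn_def; rewrite -(ler_pM2l q0) -(ltr_pM2l q0) mulrA -exprS -!natrM.
have /andP[lo hi] := truncn_itv (y0 N.+1).
apply/andP; split.
  by apply: le_trans lo; rewrite ler_nat mulnC leq_divM.
by apply: lt_le_trans hi _; rewrite ler_nat mulnC ltn_ceil.
Qed.

(** The first N digits, read as an integer in base q, give the floor of q^N x. Hence prescribing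
    them confines x to an interval of length q^-N, which yields [word_uniform]. *)
Lemma word_valueE N x : 0 <= x < 1 -> word_value (word N x) = scaled_trunc N x.
Proof.
move=> /andP[x0 x1]; elim: N => [|N ih].
  by apply/esym/truncn_def; rewrite expr0 mul1r x0.
rewrite /word mkseqS word_value_rcons -/(word N x) ih enum_valK /=.
by rewrite -(scaled_trunc_divn N x0) -divn_eq.
Qed.

Lemma scaled_trunc_measurable N v :
  measurable [set x : measurableTypeR R | scaled_trunc N x = v].
Proof.
have mle u : measurable [set x : measurableTypeR R | (scaled_trunc N x <= u)%N].
  rewrite (_ : [set _ | _] = [set x : R | q%:R ^+ N * x < u.+1%:R]).
    have := measurable_fun_ltr (T := measurableTypeR R)
      (f := fun x => q%:R ^+ N * x) (g := cst u.+1%:R).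
    move=> /(_ setT _ _ measurableT [set true] _); rewrite setTI; apply => //.
    exact: mulrl_measurable.
  by apply/seteqP; split => x /=; rewrite /scaled_trunc truncn_le_nat.
case: v => [|v].
  by have := mle 0%N; congr measurable; apply/seteqP; split => x /=;
    rewrite leqn0 => /eqP.
have := measurableD (mle v.+1) (mle v); congr measurable; apply/seteqP; split => x /=.
  by move=> [le1 /negP]; rewrite -ltnNge => lt1; apply/eqP; rewrite eqn_leq le1.
by move=> ->; split => //; rewrite ltnn.
Qed.

Lemma letter_measurable k a : measurable [set x : measurableTypeR R | letter k x = a].
Proof.
rewrite (_ : [set _ | _] = \bigcup_v
  (if (v %% q)%N == enum_rank a then [set x : R | scaled_trunc k.+1 x = v] else set0)).
  apply: bigcupT_measurable => v; case: ifP => _ //; exact: scaled_trunc_measurable.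
apply/seteqP; split => x /=.
  move=> xa; exists (scaled_trunc k.+1 x) => //.
  have -> : (scaled_trunc k.+1 x %% q)%N = enum_rank a.
    by rewrite -xa /letter enum_valK.
  by rewrite eqxx.
move=> [v _]; case: eqP => // va /= xv.
rewrite /letter -[RHS](enum_rankK a); congr enum_val.
by apply/val_inj; rewrite /= xv.
Qed.

Lemma word_measurable N w : measurable [set x : measurableTypeR R | word N x = w].
Proof.
elim: N w => [|N ih] w.
  case: w => [|a w]; rewrite /word /mkseq /=.
    by rewrite (_ : [set _ | _] = setT)//; apply/seteqP; split.
  by rewrite (_ : [set _ | _] = set0)//; apply/seteqP; split.
case/lastP: w => [|w a].
  by rewrite (_ : [set _ | _] = set0)//; apply/seteqP; split.
have := measurableI _ _ (ih w) (letter_measurable N a).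
congr measurable; apply/seteqP; split => x /=; rewrite /word mkseqS.
  by move=> [-> ->].
by move=> /rcons_inj[-> ->].
Qed.

Lemma word_uniform N w : size w = N ->
  unit_measure [set x : measurableTypeR R | word N x = w] = (q%:R ^- N)%:E.
Proof.
move=> sw; have q0 : 0 < q%:R ^+ N :> R by rewrite exprn_gt0// ltr0n.
rewrite /unit_measure /mrestr.
rewrite (_ : _ `&` _ = `[(word_value w)%:R / q%:R ^+ N,
    (word_value w).+1%:R / q%:R ^+ N[%classic); last first.
  apply/seteqP; split => x /=; rewrite !in_itv /= ler_pdivrMr// ltr_pdivlMr// mulrC.
    move=> [wx x01]; have := word_valueE N x01; rewrite wx /scaled_trunc => ->.
    apply: truncn_itv; apply: mulr_ge0; first exact: ltW.
    by case/andP : x01.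
  move=> /andP[lo hi].
  have x01 : 0 <= x < 1.
    rewrite -(pmulr_rge0 _ q0) (le_trans _ lo)//=.
    rewrite -(ltr_pM2l q0) mulr1 (lt_le_trans hi)// -natrX ler_nat -sw.
    exact: word_value_lt.
  split => //; apply: word_value_inj; first by rewrite size_mkseq.
  by rewrite word_valueE//; apply: truncn_def; rewrite lo.
rewrite lebesgue_measure_itv /= lte_fin ltr_pM2r ?invr_gt0// ltr_nat leqnn.
by rewrite -EFinD -mulrBl -natr1 addrC addKr mul1r.
Qed.

Lemma word_set_measurable N (Q : pred (seq A)) :
  measurable [set x : measurableTypeR R | Q (word N x)].
Proof.
rewrite (_ : [set _ | _] = \bigcup_(t in [set t : N.-tuple A | Q t])
    [set x : measurableTypeR R | word N x = t]).
  apply: fin_bigcup_measurable => // t _; exact: word_measurable.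
apply/seteqP; split => [x Qx|x [t /= Qt ->]//].
by exists [tuple of mkseq (letter^~ x) N].
Qed.

Lemma word_probability N (Q : pred (seq A)) :
  unit_measure [set x : measurableTypeR R | Q (word N x)] =
  (wavg N (fun w => (Q w)%:R))%:E.
Proof.
pose f (x : measurableTypeR R) : N.-tuple A := [tuple of mkseq (letter^~ x) N].
have mf t : measurable (f @^-1` [set t]).
  have := word_measurable N t; congr measurable; apply/seteqP; split => x /=.
    by move=> wt; apply/val_inj.
  by move=> <-.
have Pf t : unit_measure (f @^-1` [set t]) = (q%:R ^- N)%:E.
  rewrite -(word_uniform (size_tuple t)); congr (unit_measure _).
  apply/seteqP; split => x /=; first by move=> <-.
  by move=> wt; apply/val_inj.
have := @fine_probability_preimage R _ (measurableTypeR R) unit_measure _ f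
  (index_enum (N.-tuple A)) (index_enum_uniq _) (fun w => mem_index_enum _) mf
  (fun t => Q t).
move=> E; have fP : unit_measure [set x : measurableTypeR R | Q (word N x)] \is a fin_num.
  by apply: fin_num_measure; exact: word_set_measurable.
rewrite -(fineK fP); congr EFin; apply: etrans E _.
rewrite /wavg /avg mulr_suml big_mkcond /=.
apply: eq_bigr => t _; rewrite Pf card_tuple natrX /=.
by case: (Q t); rewrite ?mul1r ?mul0r.
Qed.

End Digits.

(** * The random walk driven by the digits *)

Section DigitWalk.
Context {R : realType} {B : completeNormedModType R} {A : finType}.
Hypothesis A_gt0 : (0 < #|A|)%N.
Variable s : A -> B.

Lemma wavg_prod N a0 (g : nat -> A -> R) :
  wavg N (fun w => \prod_(i < N) g i (nth a0 w i)) = \prod_(i < N) avg (g i).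
Proof.
elim: N g => [|N ih] g; first by rewrite wavg0 !big_ord0.
rewrite wavgS big_ord_recl -[X in _ * X](ih (fun i => g i.+1)) -avgZr; apply: eq_avg => a.
by rewrite /wavg -avgZ; apply: eq_avg => t; rewrite big_ord_recl.
Qed.

Lemma prod_fset_ord (J : {fset nat}) N (F : nat -> R) :
  (forall i, i \in J -> (i < N)%N) ->
  \prod_(i < N | val i \in J) F i = \prod_(i <- J) F i.
Proof.
move=> JN; rewrite -(big_mkord (fun i => i \in J) F) -big_filter.
apply/perm_big/uniq_perm => [||i]; [exact/filter_uniq/iota_uniq|exact: fset_uniq|].
by rewrite mem_filter mem_index_iota /=; case iJ: (i \in J) => //=; rewrite JN.
Qed.

(** Embed J in the positions of a word of length max J + 1; unconstrained positions contribute a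
    factor 1. This yields both the independence and the common law of the letters. *)
Lemma letters_probability (J : {fset nat}) (C : nat -> pred A) :
  unit_measure (\bigcap_(i in [set` J])
    [set x : measurableTypeR R | C i (letter A_gt0 i x)]) =
  (\prod_(i <- J) avg (fun a => (C i a)%:R))%:E.
Proof.
have a0 : A by exact: enum_val (Ordinal A_gt0).
pose N := (\max_(i <- J) i).+1.
have JN i : i \in J -> (i < N)%N by move=> iJ; rewrite ltnS; exact: leq_bigmax_seq.
pose Q (w : seq A) := all (fun i => C i (nth a0 w i)) J.
rewrite (_ : \bigcap_(i in _) _ = [set x | Q (word A_gt0 N x)]); last first.
  apply/seteqP; split => x /=.
    move=> h; apply/allP => i iJ; rewrite nth_mkseq; last exact: JN.
    exact: h.
  by move=> /allP h i /= iJ; have := h i iJ; rewrite nth_mkseq// JN.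
rewrite word_probability; congr EFin.
pose g i a : R := if i \in J then (C i a)%:R else 1.
transitivity (wavg N (fun w => \prod_(i < N) g i (nth a0 w i))).
  apply: eq_avg => t /=; rewrite /g -big_mkcond /=.
  rewrite (prod_fset_ord (fun i => (C i (nth a0 t i))%:R) JN).
  rewrite /Q; elim: (enum_fset J) => [|i l ih] /=; first by rewrite big_nil.
  by rewrite big_cons -ih -natrM mulnb.
rewrite wavg_prod (bigID (fun i : 'I_N => val i \in J)) /= [X in _ * X]big1 ?mulr1; last first.
  by move=> i /negbTE iJ; rewrite -[RHS](@avg_cst R A 1 A_gt0) /g iJ.
rewrite (prod_fset_ord (fun i => avg (g i)) JN).
by rewrite big_seq [RHS]big_seq; apply: eq_bigr => i iJ; rewrite /g iJ.
Qed.

Definition digit_walk (k : nat) (x : measurableTypeR R) : B := s (letter A_gt0 k x).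

Lemma digit_walk_random_variable k : random_variable (digit_walk k).
Proof.
move=> _ C mC; rewrite setTI.
rewrite (_ : _ @^-1` _ = \bigcup_(a in [set a : A | C (s a)])
    [set x : measurableTypeR R | letter A_gt0 k x = a]).
  by apply: fin_bigcup_measurable => // a _; exact: letter_measurable.
apply/seteqP; split => [x Cx|x [a /= Ca xa]]; last by rewrite /digit_walk xa.
by exists (letter A_gt0 k x).
Qed.

Lemma digit_walk_preimage k (C : set B) :
  unit_measure (digit_walk k @^-1` C) = (avg (fun a => `[< C (s a) >]%:R))%:E.
Proof.
have := letters_probability [fset k]%fset (fun _ a => `[< C (s a) >]).
rewrite big_seq_fset1 => <-; congr (unit_measure _).
apply/seteqP; split => x /=.
  by move=> Cx i /=; rewrite inE => /eqP ->; exact/asboolP.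
by move=> /(_ k) /=; rewrite inE => /(_ (eqxx _)) /asboolP.
Qed.

Lemma digit_walk_copies :
  independent_copies unit_measure unit_measure (digit_walk 0) digit_walk.
Proof.
split; first exact: digit_walk_random_variable.
- by move=> j C _; exact: etrans (digit_walk_preimage _ _) (esym (digit_walk_preimage _ _)).
move=> J C mC.
rewrite (eq_bigr (fun i => (avg (fun a => `[< C i (s a) >]%:R))%:E)); last first.
  by move=> i _; exact: digit_walk_preimage.
rewrite -(big_morph EFin (@EFinM R) erefl).
rewrite -(letters_probability J (fun i a => `[< C i (s a) >])).
by congr (unit_measure _); apply/seteqP; split => x h i /= iJ; have := h i iJ => /asboolP.
Qed.

Lemma digit_walk_crossed r n x : 0 <= r ->
  crossed digit_walk r n x <-> ~~ confined s r 0 (word A_gt0 n x).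
Proof.
move=> r0.
have psum k y : y + \sum_(a <- word A_gt0 k x) s a = y + partial_sum digit_walk k x.
  congr (_ + _); rewrite /partial_sum /word /mkseq big_map.
  by rewrite -[k in iota 0 k]subn0 big_mkord.
elim: n => [|n ih]; first by rewrite crossed0//.
rewrite crossedS /word mkseqS -cats1 confined_cat -/(word A_gt0 n x) negb_and.
rewrite /= andbT psum add0r -ltNge /partial_sum big_ord_recr /= -/(partial_sum _ _ _).
split.
  by move=> [/ih ->//|->]; rewrite orbT.
by move=> /orP[/ih|]; [left|right].
Qed.

Lemma digit_walk_not_crossed r n : 0 <= r ->
  unit_measure (~` crossed digit_walk r n) = (stay s r n)%:E.
Proof.
move=> r0; rewrite -(word_probability A_gt0); congr (unit_measure _).
apply/seteqP; split => x /=.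
  by move=> nc; apply: contrapT => /negP /(digit_walk_crossed _ _ r0).
by move=> c /(digit_walk_crossed _ _ r0); rewrite c.
Qed.

Lemma stay_nonincreasing r m n : (m <= n)%N -> stay s r n <= stay s r m.
Proof.
have leaveE' k : stay s r k = 1 - leave s r 0 k by rewrite leaveE// opprB addrC subrK.
move=> mn; rewrite !leaveE' lerD2l lerN2.
elim: n mn => [|n ih]; first by rewrite leqn0 => /eqP ->.
rewrite leq_eqVlt => /orP[/eqP ->//|mn].
by apply: le_trans (ih mn) _; exact: leave_nondecreasing.
Qed.

(** Within a block of n consecutive times, each term is at most the first, whose time is a multiple
    of n, so [stay_mul] applies. *)
Lemma sum_stay_le r n m : 0 <= r ->
  \sum_(k < m * n) stay s r k <= n%:R * \sum_(j < m) stay s (r + r) n ^+ j.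
Proof.
move=> r0; elim: m => [|m ih]; first by rewrite mul0n !big_ord0 mulr0.
rewrite big_ord_recr mulrDr /=.
rewrite -(big_mkord xpredT (fun k => stay s r k)) mulSnr.
rewrite (big_cat_nat (n := m * n)) ?leq_addr//= big_mkord lerD//.
rewrite (@le_trans _ _ (\sum_(m * n <= k < m * n + n) stay s r (m * n)))//.
  rewrite big_nat_cond [leRHS]big_nat_cond; apply: ler_sum => k /andP[/andP[mk _] _].
  exact: stay_nonincreasing.
by rewrite sumr_const_nat addKn -(mulr_natl (stay s r (m * n))) ler_wpM2l// stay_mul.
Qed.

Hypothesis sepB : separable B.

(** Summing the survival probabilities in blocks gives a geometric series, so E T_r <= n / P(T_2r <=
    n); a lower bound on E T_r then limits the exit probability. *)
Lemma digit_walk_leave_le r n (D : R) : 0 <= r -> 0 < D ->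
  (D%:E <= \int[unit_measure]_x exit_time digit_walk r x)%E ->
  leave s (r + r) 0 n <= n%:R / D.
Proof.
move=> r0 D0; rewrite (integral_exit_time unit_measure sepB digit_walk_random_variable)//.
set rho := stay s (r + r) n; have lE : leave s (r + r) 0 n = 1 - rho by rewrite leaveE.
have l0 := leave_ge0 s (r + r) 0 n.
have rho0 : 0 <= rho by apply: wavg_ge0.
have [l00|lpos] := leP (leave s (r + r) 0 n) 0.
  by rewrite (le_trans l00)// mulr_ge0// invr_ge0 ltW.
move=> DE; suff : D <= n%:R / leave s (r + r) 0 n.
  by rewrite ler_pdivlMr// mulrC ler_pdivlMr// .
rewrite -lee_fin; apply: le_trans DE _.
have geo m : \sum_(j < m) rho ^+ j <= (leave s (r + r) 0 n)^-1.
  rewrite -(ler_pM2l lpos) divff ?gt_eqF// lE.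
  have -> : (1 - rho) * \sum_(j < m) rho ^+ j = 1 - rho ^+ m.
    elim: m => [|m ih]; first by rewrite big_ord0 mulr0 expr0 subrr.
    by rewrite big_ord_recr /= mulrDr ih exprS; ring.
  by rewrite gerBl exprn_ge0.
apply: lime_le; first by apply: is_cvg_nneseries.
apply: nearW => m /=.
rewrite big_mkord (eq_bigr (fun k : 'I_m => (stay s r k)%:E)); last first.
  by move=> k _; exact: digit_walk_not_crossed.
rewrite sumEFin lee_fin.
have n0 : (0 < n)%N by case: n lpos {rho lE l0 rho0 geo} => //; rewrite /leave wavg0 /= ltxx.
(* Here n > 0, since no exit occurs in zero steps; hence m <= m n and the partial sum extends to
   whole blocks. *)
apply: (@le_trans _ _ (\sum_(k < m * n) stay s r k)).
  rewrite -!(big_mkord xpredT (fun k => stay s r k)).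
  rewrite [leRHS](big_cat_nat (n := m)) ?leq_pmulr//= lerDl sumr_ge0// => k _.
  exact: wavg_ge0.
by apply: le_trans (sum_stay_le _ _ r0) _; rewrite ler_wpM2l.
Qed.

End DigitWalk.

(** * The equivalence *)

Section DigitWalkLaw.
Context {R : realType} {B : completeNormedModType R} {A : finType}.
Hypothesis A_gt0 : (0 < #|A|)%N.

Lemma letter_uniform a :
  unit_measure (letter A_gt0 0 @^-1` [set a] : set (measurableTypeR R)) = (#|A|%:R^-1)%:E.
Proof.
have := @letters_probability R _ A_gt0 [fset 0%N]%fset (fun=> pred1 a).
rewrite big_seq_fset1 (_ : avg _ = #|A|%:R^-1) => [<-|]; last first.
  rewrite /avg (bigD1 a)//= eqxx big1 ?addr0 ?mul1r// => i /negbTE ia.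
  by rewrite ia.
congr (unit_measure _); apply/seteqP; split => x /=.
  by move=> xa i /=; rewrite inE => /eqP ->; apply/eqP.
by move=> /(_ 0%N) /=; rewrite inE => /(_ (eqxx _)) /eqP.
Qed.

Variable s : A -> B.
Let X := digit_walk A_gt0 s 0 : measurableTypeR R -> B.

Let mX : random_variable X. Proof. exact: digit_walk_random_variable. Qed.

Lemma digit_walk_sqr :
  (\int[unit_measure]_x (`|X x| ^+ 2)%:E = (avg (fun a => `|s a| ^+ 2))%:E)%E.
Proof.
rewrite (@integral_finite_values R _ (measurableTypeR R) unit_measure _
  (letter A_gt0 0) (index_enum A) (index_enum_uniq _) (fun w => mem_index_enum _)
  (fun a => letter_measurable A_gt0 0 a) (fun a => `|s a| ^+ 2)); last first.
  by move=> a; exact: sqr_ge0.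
congr EFin; rewrite /avg mulr_suml; apply: eq_bigr => a _; congr (_ * _).
exact: (congr1 fine (letter_uniform a)).
Qed.

Lemma digit_walk_simple : simple_function X.
Proof.
split; first exact: mX.
apply: (@sub_finite_set _ _ (s @` [set: A])); last exact: finite_image.
by move=> _ [x _ <-]; exists (letter A_gt0 0 x).
Qed.

Lemma digit_walk_bochner : \sum_a s a = 0 -> is_bochner unit_measure X 0.
Proof.
move=> s0; split; first exact: mX.
exists (fun=> X); split.
- by move=> _; exact: digit_walk_simple.
- rewrite (_ : (fun _ => _) = (fun=> 0%E)); first exact: cvg_cst.
  apply/funext => k; rewrite integral0_eq// => x _.
  by rewrite subrr normr0.
- rewrite (_ : (fun _ => _) = (fun=> 0)); first exact: cvg_cst.
  apply/funext => k.
  rewrite (@simple_expectation_comp R B _ (measurableTypeR R) unit_measure _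
    (letter A_gt0 0) (index_enum A) (index_enum_uniq _) (fun w => mem_index_enum _)
    (fun a => letter_measurable A_gt0 0 a) s).
  rewrite (eq_bigr (fun a => #|A|%:R^-1 *: s a)); last first.
    by move=> a _; congr (_ *: _); exact: (congr1 fine (letter_uniform a)).
  by rewrite -scaler_sumr s0 scaler0.
Qed.

Lemma digit_walk_non_degenerate a a' : s a <> s a' -> non_degenerate unit_measure X.
Proof.
move=> neq [b [N [mN N0 sub]]]; apply: neq.
suff sb a1 : s a1 = b by rewrite !sb.
apply: contrapT => nb.
have : (unit_measure (letter A_gt0 0 @^-1` [set a1] : set (measurableTypeR R)) <= 0)%E.
  rewrite -N0; apply: le_measure; rewrite ?inE//; first exact: letter_measurable.
  by move=> x /= xa; apply: sub => /=; rewrite /X /digit_walk xa.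
by rewrite letter_uniform lee_fin leNgt invr_gt0 ltr0n A_gt0.
Qed.

Hypothesis sepB : separable B.

(** Steps bounded by r make G vanish and truncation trivial, and a zero sum of steps makes M vanish,
    so only K is left. *)
Lemma digit_walk_h r : 0 < r -> (forall a, `|s a| <= r) -> \sum_a s a = 0 ->
  h unit_measure X r = avg (fun a => `|s a| ^+ 2) / r ^+ 2.
Proof.
move=> r0 sr s0.
have trunc : truncate r \o X = X.
  by apply/funext => x /=; rewrite truncateE /X /digit_walk sr.
have -> : h unit_measure X r = K unit_measure X r.
  rewrite /h (_ : G _ _ _ = 0) ?add0r; last first.
    rewrite /G (_ : [set w | _] = set0) ?measure0//.
    by apply/seteqP; split => // x /=; rewrite ltNge /X /digit_walk sr.
  have /(is_bochner_unique sepB (digit_walk_bochner s0)) :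
      is_bochner unit_measure X (r *: M unit_measure X r).
    by rewrite -{1}trunc; exact: truncate_mean.
  by move=> /esym/eqP; rewrite scaler_eq0 gt_eqF//= => /eqP ->; rewrite normr0 addr0.
apply: (mulfI (x := r ^+ 2)); first by rewrite expf_neq0 ?gt_eqF.
rewrite [RHS]mulrC divfK ?expf_neq0 ?gt_eqF//.
apply: EFin_inj; rewrite -(truncate_sqr r0 unit_measure mX) -digit_walk_sqr.
by apply: eq_integral => x _; rewrite -[truncate r (X x)]/((truncate r \o X) x) trunc.
Qed.

End DigitWalkLaw.

(** * From mean exit times to Rademacher sums *)

Section MeanToRademacher.
Context {R : realType} {B : completeNormedModType R}.
Hypothesis sepB : separable B.

Lemma sum_signed_letters n (x : 'I_n -> B) : \sum_a signed_step x a = 0.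
Proof.
rewrite -(pair_big xpredT xpredT (fun i b => signed_step x (i, b))) /=.
apply: big1 => i _; rewrite big_bool /signed_step /= expr1 expr0.
by rewrite scaleN1r scale1r addNr.
Qed.

Lemma avg_sqr_signed_step n (x : 'I_n -> B) :
  avg (fun a => `|signed_step x a| ^+ 2) = (\sum_i `|x i| ^+ 2) / n%:R.
Proof.
rewrite /avg -(pair_big xpredT xpredT (fun i b => `|signed_step x (i, b)| ^+ 2)) /=.
rewrite (eq_bigr (fun i => 2 * `|x i| ^+ 2)); last first.
  move=> i _; rewrite big_bool /signed_step /= expr1 expr0 scaleN1r scale1r normrN.
  by ring.
rewrite -mulr_sumr card_prod card_bool card_ord natrM.
by rewrite [n%:R * _]mulrC invfM mulrA; congr (_ / _); rewrite mulrAC divff ?mul1r.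
Qed.

Lemma exit_mean_rademacher (c : R) n (x : 'I_n -> B) : 0 < c ->
  exit_mean_with B c -> (0 < n)%N ->
  avg (fun e : {ffun 'I_n -> bool} => `|\sum_i (-1) ^+ e i *: x i| ^+ 2) <=
  8 * (2 * (1 + 8 / c) + 1) ^+ 2 * \sum_i `|x i| ^+ 2.
Proof.
(* For r = t sqrt S, (ii) bounds the probability of leaving radius 2r by 1 / (c t^2). The summand
   8/c brings this below 1/8, and the summand 1 ensures that r bounds the steps. *)
move=> c0 mean n0; set t := 1 + 8 / c; set S := \sum_i `|x i| ^+ 2.
have c8 : 0 < 8 / c by rewrite divr_gt0.
have S0 : 0 <= S by rewrite sumr_ge0// => i _; exact: sqr_ge0.
(* If all x_i vanish the step is degenerate, and (ii) does not apply to it. *)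
have [xz|] := pselect (forall i, x i = 0).
  rewrite (eq_avg (g := fun=> 0)).
    rewrite avg_cst; last by rewrite card_ffun card_bool expn_gt0.
    by rewrite mulr_ge0// mulr_ge0// sqr_ge0.
  by move=> e; rewrite big1 ?normr0 ?expr0n// => i _; rewrite xz scaler0.
move=> /existsNP[i0 xi0].
have Spos : 0 < S.
  have xi0' : 0 < `|x i0| ^+ 2 by rewrite exprn_gt0// normr_gt0; exact/eqP.
  by rewrite /S (bigD1 i0)//= (lt_le_trans xi0')// lerDl sumr_ge0.
pose sigma := Num.sqrt S.
have sigma0 : 0 < sigma by rewrite sqrtr_gt0.
have sigma2 : sigma ^+ 2 = S by rewrite sqr_sqrtr.
have step_le a : `|signed_step x a| <= sigma.
  rewrite /signed_step normrZ normrX normrN1 expr1n mul1r.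
  rewrite -ler_sqr ?nnegrE ?(ltW sigma0)// sigma2 /S (bigD1 a.1)//= lerDl.
  by rewrite sumr_ge0.
have A0 := letters_gt0 n0.
pose r := t * sigma; have r0 : 0 < r by rewrite mulr_gt0// addr_gt0.
have step_r a : `|signed_step x a| <= r.
  by rewrite (le_trans (step_le a))// /r ler_peMl ?(ltW sigma0)// /t lerDl (ltW c8).
have hE := digit_walk_h A0 sepB r0 step_r (sum_signed_letters x).
have neq : signed_step x (i0, false) <> signed_step x (i0, true).
  rewrite /signed_step /= expr0 expr1 scale1r scaleN1r => /eqP.
  by rewrite -subr_eq0 opprK -mulr2n -scaler_nat scaler_eq0 pnatr_eq0/= => /eqP.
have [mW law ind] := @digit_walk_copies R B _ A0 (signed_step x).
have := mean _ _ _ _ _ _ _ _ (mW 0%N) (digit_walk_non_degenerate neq)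
  (digit_walk_copies A0 (signed_step x)) r r0.
rewrite hE avg_sqr_signed_step -/S => ET.
have nR : 0 < n%:R :> R by rewrite ltr0n.
have hpos : 0 < S / n%:R / r ^+ 2 by rewrite !divr_gt0// exprn_gt0.
have leave_le : leave (signed_step x) (r + r) 0 n <= 8^-1.
  apply: le_trans (digit_walk_leave_le sepB n (ltW r0) (divr_gt0 c0 hpos) ET) _.
  have -> : n%:R / (c / (S / n%:R / r ^+ 2)) = (c * t ^+ 2)^-1.
    rewrite /r exprMn sigma2; field; rewrite !gt_eqF//.
    by rewrite addr_gt0.
  rewrite lef_pV2 ?posrE ?mulr_gt0 ?exprn_gt0 ?addr_gt0//.
  have -> : 8 = c * (8 / c) by field; rewrite gt_eqF.
  rewrite ler_wpM2l ?(ltW c0)//.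
  by rewrite /t; move: c8; set u := 8 / c => u0; nra.
apply: le_trans (rademacher_le_walk x n0) _.
have rr0 : 0 <= r + r by rewrite addr_ge0 ?ltW.
have := second_moment_le A0 step_le (ltW sigma0) rr0 leave_le.
have -> : 2 * (r + r + sigma) ^+ 2 = 2 * (2 * t + 1) ^+ 2 * S.
  by rewrite /r -sigma2; ring.
by lra.
Qed.

End MeanToRademacher.

(** * From Rademacher sums to type 2 *)

Section RademacherToTypeTwo.
Context {R : realType}.

Lemma exit_mean_type2 (B : completeNormedModType R) (c : R) : separable B -> 0 < c ->
  exit_mean_with B c -> type2_with B (32 * (2 * (1 + 8 / c) + 1) ^+ 2).
Proof.
move=> sepB c0 mean d T P n X n1 mX indX bX fX.
set C := 8 * (2 * (1 + 8 / c) + 1) ^+ 2.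
have C0 : 0 <= C by rewrite mulr_ge0 ?sqr_ge0.
have -> : 32 * (2 * (1 + 8 / c) + 1) ^+ 2 = 4 * C by rewrite /C; ring.
pose E := {ffun 'I_n -> bool}; pose N : R := #|E|%:R.
have N0 : 0 < N by rewrite /N ltr0n card_ffun card_bool expn_gt0.
have cX i : centered P (X i) by exact: (centered_bochner sepB).
have cNX i : centered P (fun w => - X i w) by exact: centeredN.
pose I (e : E) w := (`|\sum_i (-1) ^+ e i *: X i w| ^+ 2)%:E.
have mI e : measurable_fun setT (I e).
  apply: measurable_sqr_norm; apply: random_variable_sum => // i _.
  exact: random_variableZ.
have I0 e w : setT w -> (0 <= I e w)%E by rewrite lee_fin sqr_ge0.
set S := (\int[P]_w (`|\sum_(i < n) X i w| ^+ 2)%:E)%E.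
have Se e : (S <= 4%:E * \int[P]_w I e w)%E.
  by apply: sign_le_sum.
(* Multiplying by the number N of sign patterns turns their average into a finite sum of integrals.
   The final 32 is 4 from [sign_le_sum] times 8 from the Rademacher bound. *)
rewrite -(@lee_pmul2l _ N%:E) ?lte_fin//.
have sq i : measurable_fun setT (fun w => (`|X i w| ^+ 2)%:E).
  exact: measurable_sqr_norm.
apply: (@le_trans _ _ (4%:E * \int[P]_w (\sum_e I e w))%E).
  rewrite ge0_integral_sum//= ge0_sume_distrr; last first.
    by move=> e _; apply: integral_ge0 => w _; exact: I0.
  apply: (@le_trans _ _ (\sum_(e : E) S)%E); last by apply: lee_sum => e _.
  by rewrite /N mule_natl sumr_const.
have sumE w : (\sum_e I e w <= (N * C)%:E * \sum_i (`|X i w| ^+ 2)%:E)%E.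
  rewrite !sumEFin -EFinM lee_fin.
  have := exit_mean_rademacher sepB (X ^~ w) c0 mean n1.
  by rewrite /avg ler_pdivrMr// -/C -/E -/N => h; rewrite -mulrA mulrC.
apply: (@le_trans _ _ (4%:E * ((N * C)%:E * \int[P]_w (\sum_i (`|X i w| ^+ 2)%:E)))%E).
  rewrite lee_wpmul2l ?lee_fin// -ge0_integralZl_EFin//.
  - apply: ge0_le_integral => //.
    + by move=> w _; apply: sume_ge0 => e _; exact: I0.
    + exact: emeasurable_sum.
    + by apply: measurable_funeM; exact: emeasurable_sum.
  - by move=> w _; apply: sume_ge0 => i _; rewrite lee_fin sqr_ge0.
  - exact: emeasurable_sum.
  - by rewrite mulr_ge0// ltW.
rewrite ge0_integral_sum// !muleA -!EFinM.
by rewrite (_ : 4 * (N * C) = N * (4 * C))//; ring.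
Qed.

End RademacherToTypeTwo.

Theorem theorem1p1 (R : realType) :
  (forall B : completeNormedModType R, separable B ->
     (with_some_constant type2_with B <-> with_some_constant exit_mean_with B) /\
     (with_some_constant exit_mean_with B <-> with_some_constant exit_tail_with B) /\
     (with_some_constant exit_tail_with B <-> with_some_constant type2_with B)) /\
  ((@constant_transfers R type2_with exit_mean_with /\
    @constant_transfers R exit_mean_with type2_with) /\
   (@constant_transfers R exit_mean_with exit_tail_with /\
    @constant_transfers R exit_tail_with exit_mean_with) /\
   (@constant_transfers R type2_with exit_tail_with /\
    @constant_transfers R exit_tail_with type2_with)).
Proof.
have trans (S1 S2 S3 : completeNormedModType R -> R -> Prop) :
    constant_transfers S1 S2 -> constant_transfers S2 S3 -> constant_transfers S1 S3.
  move=> S12 S23 c /S12[c1 [c10 h1]]; have [c2 [c20 h2]] := S23 _ c10.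
  by exists c2; split => // B sepB /(h1 _ sepB)/(h2 _ sepB).
have some (S1 S2 : completeNormedModType R -> R -> Prop)
    (B : completeNormedModType R) : separable B ->
    constant_transfers S1 S2 -> with_some_constant S1 B -> with_some_constant S2 B.
  move=> sepB S12 [c [c0 S1B]]; have [c1 [c10 h1]] := S12 _ c0.
  by exists c1; split => //; exact: h1.
have t23 : @constant_transfers R type2_with exit_tail_with.
  move=> c c0; exists (4 + 4 * c); split; first by rewrite addr_gt0// mulr_gt0.
  by move=> B sepB; exact: type2_exit_tail.
have t32 : @constant_transfers R exit_tail_with exit_mean_with.
  move=> c c0; exists (4 * c)^-1; split; first by rewrite invr_gt0 mulr_gt0.
  by move=> B sepB; exact: exit_tail_mean.
have t21 : @constant_transfers R exit_mean_with type2_with.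
  move=> c c0; exists (32 * (2 * (1 + 8 / c) + 1) ^+ 2); split.
    by rewrite mulr_gt0// exprn_gt0// addr_gt0// mulr_gt0// addr_gt0// divr_gt0.
  by move=> B sepB; exact: exit_mean_type2.
(* The three implications form a cycle, so composition gives the remaining ones together with their
   constants. *)
have t12 := trans _ _ _ t23 t32; have t22 := trans _ _ _ t21 t23.
have t31 := trans _ _ _ t32 t21.
split; last by [].
move=> B sepB; split; [|split]; split; exact: some.
Qed.
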